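(* Fix $\eta\in(0,1)$. Let $(K,d)$ be a compact metric space of diameter at most $1$. There exist a constant $c>0$ depending only on $\eta$, for each $\varepsilon>0$ a constant $C(\varepsilon)$ depending only on $\varepsilon$ and $\eta$, and numbers $C(K,d,n)$, $n\ge1$, depending only on $K$, $d$, $n$ and $\eta$, with $$\lim_{n\to\infty}C(K,d,n)=0,$$ such that: for every $n\ge1$, all points $x_1,\dots,x_n\in K$, and every $p\in[0,1]$ with $p\ge n^{-1+\varepsilon}$ for some $\varepsilon>0$, if $M$ is the $n\times n$ distance matrix whose $(i,j)$th entry is $d(x_i,x_j)$, then the USVT estimator $\hat M$ with tuning parameter $\eta$ satisfies $$\operatorname{MSE}(\hat M)\le\frac{C(K,d,n)}{\sqrt p}+C(\varepsilon)e^{-cnp}.$$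
   Context: The data come from a data matrix $X$ with mean $M$ under either of the following models (order $n\times n$). Asymmetric model (with $m=n$): $X$ is a random $n\times n$ matrix with independent entries, $\mathbb{E}(x_{ij})=m_{ij}$ and $|x_{ij}|\le 1$ almost surely ($X=M$ allowed); each entry of $X$ is observed with probability $p$ and unobserved with probability $1-p$, independently of everything else. Symmetric model: $X$ is symmetric, its entries on and above the diagonal are independent with $\mathbb{E}(x_{ij})=m_{ij}$ and $|x_{ij}|\le1$ almost surely; each entry on and above the diagonal is observed with probability $p$, independently of everything else, and for $i<j$ the entry $(j,i)$ is observed if and only if $(i,j)$ is. $\operatorname{MSE}(\hat M):=\mathbb{E}\big[\frac1{n^2}\sum_{i,j=1}^n(\hat m_{ij}-m_{ij})^2\big]$. USVT estimator with tuning parameter $\eta\in(0,1)$: let $y_{ij}=x_{ij}$ if $x_{ij}$ is observed and $y_{ij}=0$ otherwise, $Y=(y_{ij})$, with singular value decomposition $Y=\sum_{i=1}^n s_iu_iv_i^T$. Let $\hat p$ be the proportion of observed entries of $X$ (in the symmetric model: among those on and above the diagonal). Let $S:=\{i: s_i\ge(2+\eta)\sqrt{n\hat p}\}$ and $W:=\frac1{\hat p}\sum_{i\in S}s_iu_iv_i^T$ (if $\hat p=0$, put $W:=0$). Finally $\hat m_{ij}$ is the truncation of $w_{ij}$ to $[-1,1]$ ($\hat m_{ij}=w_{ij}$ if $|w_{ij}|\le1$, $1$ if $w_{ij}>1$, $-1$ if $w_{ij}<-1$). *)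

(* Defs.v *)
From HB Require Import structures.
From mathcomp Require Import all_boot all_order all_algebra.
From mathcomp Require Import all_classical all_reals all_analysis.
Import Order.TTheory GRing.Theory Num.Theory.
Import numFieldNormedType.Exports.

Set Implicit Arguments.
Unset Strict Implicit.
Unset Printing Implicit Defensive.

Local Open Scope classical_set_scope.
Local Open Scope ring_scope.

(* The supremum is taken in \bar R, so the diameter of set0 is -oo. *)
Definition diameter (R : realType) (K : metricType R) (A : set K) : \bar R :=
  ereal_sup [set (mdist z.1 z.2)%:E | z in A `*` A].

Definition distance_matrix (R : realType) (K : metricType R) (n : nat)
    (x : 'I_n -> K) : 'M[R]_n :=
  \matrix_(i, j) mdist (x i) (x j).

(* Mutual independence of the set systems G i, i in D: the product rule holds
   on every (finite) subfamily. *)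
Definition mutually_independent (d : measure_display) (T : measurableType d)
    (R : realType) (P : probability T R) (I : finType) (D : {set I})
    (G : I -> set_system T) : Prop :=
  forall (J : {set I}) (E : I -> set T), J \subset D ->
    (forall i, i \in J -> G i (E i)) ->
    P (\bigcap_(i in [set` J]) E i) = (\prod_(i in J) P (E i))%E.

Inductive data_model := Asymmetric | Symmetric.

(* The entries that are drawn and observed independently: all of them, or
   those on and above the diagonal. *)
Definition free_entries (mo : data_model) (n : nat) : {set 'I_n * 'I_n} :=
  [set e : 'I_n * 'I_n | if mo is Symmetric then (e.1 <= e.2)%N else true].

Section Data.
Context (d : measure_display) (T : measurableType d) (R : realType).
Context (P : probability T R) (n : nat).

(* X (i, j) is the entry x_ij, and O (i, j) w says that it is observed in the
   outcome w. *)
Implicit Types (X : 'I_n * 'I_n -> {RV P >-> R})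
               (O : 'I_n * 'I_n -> {RV P >-> bool}).

(* inl e stands for the sigma-algebra of X e, inr e for that of O e. *)
Definition data_sigma_algebra X O (k : 'I_n * 'I_n + 'I_n * 'I_n) :
    set_system T :=
  match k with
  | inl e => preimage_set_system setT (X e) measurable
  | inr e => preimage_set_system setT (O e) measurable
  end.

Record data_matrix (mo : data_model) (p : R) (M : 'M[R]_n) X O : Prop := {
  data_mean : forall i j, ('E_P[X (i, j)] = (M i j)%:E)%E ;
  data_bounded : forall e, e \in free_entries mo n ->
    {ae P, forall w, `|X e w| <= 1} ;
  data_observed : forall e, e \in free_entries mo n ->
    P (O e @^-1` [set true]) = p%:E ;
  data_independent :
    mutually_independent P
      [set k : 'I_n * 'I_n + 'I_n * 'I_n |
        match k with inl e | inr e => e \in free_entries mo n end]%SET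
      (data_sigma_algebra X O) ;
  data_symmetric : mo = Symmetric -> forall i j w,
    X (i, j) w = X (j, i) w /\ O (i, j) w = O (j, i) w
}.

Definition observed_matrix X O (w : T) : 'M[R]_n :=
  \matrix_(i, j) if O (i, j) w then X (i, j) w else 0.

Definition observed_proportion (mo : data_model) O (w : T) : R :=
  #|[set e in free_entries mo n | O e w]|%:R / #|free_entries mo n|%:R.

Definition MSE (Mhat : T -> 'M[R]_n) (M : 'M[R]_n) : \bar R :=
  ('E_P[fun w => ((n%:R ^+ 2)^-1 *
     \sum_(i < n) \sum_(j < n) (Mhat w i j - M i j) ^+ 2)%R])%E.

End Data.

Section Usvt.
Context (R : realType) (n : nat).
Implicit Types (Y U V : 'M[R]_n) (s : 'I_n -> R).

(* The singular vectors u_i and v_i are the columns of U and V. *)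
Record is_svd Y U s V : Prop := {
  svd_left : U^T *m U = 1%:M ;
  svd_right : V^T *m V = 1%:M ;
  svd_ge0 : forall i, 0 <= s i ;
  svd_sum : Y = \sum_(i < n) s i *: (col i U *m (col i V)^T)
}.

Definition usvt_W (eta phat : R) U s V : 'M[R]_n :=
  if phat == 0 then 0
  else phat^-1 *: \sum_(i < n | (2 + eta) * Num.sqrt (n%:R * phat) <= s i)
         s i *: (col i U *m (col i V)^T).

Definition truncate (x : R) : R :=
  if 1 < x then 1 else if x < -1 then -1 else x.

(* Mhat is the USVT estimate computed from Y and phat through some singular
   value decomposition of Y; it does not depend on which one is used, since
   the threshold keeps or drops all equal singular values together. *)
Definition is_usvt (eta : R) Y (phat : R) (Mhat : 'M[R]_n) : Prop :=
  exists U s V, is_svd Y U s V /\ Mhat = map_mx truncate (usvt_W eta phat U s V).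

End Usvt.

(* Main.v *)
Require Import Defs.
From HB Require Import structures.
From mathcomp Require Import all_boot all_order all_algebra.
From mathcomp Require Import all_classical all_reals all_analysis.
From mathcomp Require Import measurable_realfun ring lra zify.
Import Order.TTheory GRing.Theory Num.Theory.
Import numFieldNormedType.Exports.

Set Implicit Arguments.
Unset Strict Implicit.
Unset Printing Implicit Defensive.

Local Open Scope classical_set_scope.
Local Open Scope ring_scope.

(** Only p >= delta for a fixed delta > 0 matters: the error is at most 4, so
C(K,d,n) may absorb all smaller p provided that it tends to 0 slowly enough, and
C(epsilon) = 0 works.  It remains to see that for every delta the error tends to
0 uniformly in p >= delta, the points and the data.

Let E = Y - p M.  The moment method with a fixed exponent m gives
E tr(E^T E)^m <= C_m n^m + 2 n (4 n p)^m, so with t1 = (2 + eta/4) sqrt(n p) the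
ratio tr(E^T E)^m / (omega n t1^(2m)) is small in mean if m is large and then n
is large.  If it is at most 1, at most kappa n singular values of Y pass the
threshold: for singular pairs (u_i, v_i) that pass, sum u_i^T Y v_i is at least
the threshold times their number, whereas sum u_i^T E v_i is about t1 times that
number at most, and the contribution of M is negligible since the compactness of
K makes M, up to a small entrywise error, a matrix of bounded rank.  Then
|Yhat - p M|^2 = <Yhat, E> - p <M, E> + p <M, Y - Yhat> is o(n^2) term by term.
Powers of bilinear forms are compared with traces by iterating the
Cauchy-Schwarz inequality, so that no spectral theorem is needed. *)

(** * Bounded random variables and independence *)

(** The exponent m can stay fixed because no operator norm bound on E is sought. The trace sums the
    2m-th powers of up to n singular values, so its mean carries a factor n, and absorbing that
    factor would take m of order log n and a much finer count of walks. Dividing by omega n t1^(2m)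
    concedes instead that a small proportion of the singular values may be large; this is affordable
    since only an error of o(n^2) in the squared Frobenius norm is required.

    With m fixed and p >= delta, the walks that visit at most m vertices are negligible by a factor
    1/n. The others run twice through the edges of a tree and are encoded by bit words of length 2m;
    there are 4^m of these, whence the level 4np, whose root is the 2 in the threshold. Since 2 +
    eta/4 exceeds 2, the ratio decays geometrically in m.

    The numbers C(K,d,n) must serve all points, all data and all p at once, so they are defined as
    infima of admissible constants. Cutting at p = (e/4)^2, below which the trivial bound 4 is at
    most e / sqrt p, shows that they tend to 0. *)

Section BoundedMeasurable.
Context (d : measure_display) (T : measurableType d) (R : realType).
Context (P : probability T R).
Implicit Types f g : T -> R.

(** The bound holds everywhere, not just almost surely, so the class is closed under products and
    integrability is automatic. The entries of the data enter it after truncation. *)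
Definition bounded_measurable f :=
  measurable_fun setT f /\ exists c : R, forall w, `|f w| <= c.

Definition mean_value f : R := \int[P]_w f w.
Local Notation mean := mean_value.

Lemma bm_integrable f : bounded_measurable f -> P.-integrable setT (EFin \o f).
Proof.
case=> mf [c fc]; apply: measurable_bounded_integrable => //.
  by rewrite -ge0_fin_numE// fin_num_measure.
exists c; split; first exact: num_real.
by move=> x cx y _; exact: le_trans (fc y) (ltW cx).
Qed.

Lemma bm_cst c : bounded_measurable (fun _ => c).
Proof. by split; [exact: measurable_cst|exists `|c|]. Qed.

Lemma bm_add f g : bounded_measurable f -> bounded_measurable g ->
  bounded_measurable (fun w => f w + g w).
Proof.
case=> mf [a fa] [mg [b gb]]; split; first exact: measurable_funD.
exists (a + b) => w; apply: (le_trans (ler_normD _ _)); exact: lerD.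
Qed.

Lemma bm_mul f g : bounded_measurable f -> bounded_measurable g ->
  bounded_measurable (fun w => f w * g w).
Proof.
case=> mf [a fa] [mg [b gb]]; split; first exact: measurable_funM.
by exists (a * b) => w; rewrite normrM ler_pM.
Qed.

Lemma bm_opp f : bounded_measurable f -> bounded_measurable (fun w => - f w).
Proof.
move=> bf; have := bm_mul (bm_cst (-1)) bf.
by congr bounded_measurable; apply/funext => w; rewrite mulN1r.
Qed.

Lemma bm_sum (I : Type) (r : seq I) (p : pred I) (f : I -> T -> R) :
  (forall i, bounded_measurable (f i)) ->
  bounded_measurable (fun w => \sum_(i <- r | p i) f i w).
Proof.
move=> bf; elim: r => [|i r IH].
  by under eq_fun do rewrite big_nil; exact: bm_cst.
under eq_fun do rewrite big_cons.
by case: (p i) => //; exact: bm_add.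
Qed.

Lemma bm_prod (I : Type) (r : seq I) (p : pred I) (f : I -> T -> R) :
  (forall i, p i -> bounded_measurable (f i)) ->
  bounded_measurable (fun w => \prod_(i <- r | p i) f i w).
Proof.
move=> bf; elim: r => [|i r IH].
  by under eq_fun do rewrite big_nil; exact: bm_cst.
under eq_fun do rewrite big_cons.
by have := bf i; case: (p i) => // /(_ isT) bi; exact: bm_mul.
Qed.

Lemma bm_exp f k : bounded_measurable f -> bounded_measurable (fun w => f w ^+ k).
Proof.
move=> bf; elim: k => [|k IH].
  by under eq_fun do rewrite expr0; exact: bm_cst.
by under eq_fun do rewrite exprS; exact: bm_mul.
Qed.

Lemma bm_indic (A : set T) : measurable A -> bounded_measurable (\1_A : T -> R).
Proof.
move=> mA; split; first exact: measurable_indic.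
by exists 1 => w; rewrite indicE; case: (_ \in _); rewrite ?normr1 ?normr0.
Qed.

Lemma mean_cst c : mean (fun _ => c) = c.
Proof.
have := Rintegral_cst P (measurableT : measurable [set: T]) c.
by rewrite [X in fine X](@probability_setT _ _ _ P) mulr1.
Qed.

Lemma mean_add f g : bounded_measurable f -> bounded_measurable g ->
  mean (fun w => f w + g w) = mean f + mean g.
Proof. by move=> bf bg; rewrite /mean_value RintegralD//; exact: bm_integrable. Qed.

Lemma mean_scale c f : bounded_measurable f ->
  mean (fun w => c * f w) = c * mean f.
Proof. by move=> bf; rewrite /mean_value RintegralZl//; exact: bm_integrable. Qed.

Lemma mean_opp f : bounded_measurable f -> mean (fun w => - f w) = - mean f.
Proof.
move=> bf; rewrite -mulN1r -mean_scale//.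
by congr mean_value; apply/funext => w; rewrite mulN1r.
Qed.

Lemma mean_sub f g : bounded_measurable f -> bounded_measurable g ->
  mean (fun w => f w - g w) = mean f - mean g.
Proof. by move=> bf bg; rewrite mean_add ?mean_opp//; exact: bm_opp. Qed.

Lemma mean_sum (I : Type) (r : seq I) (p : pred I) (f : I -> T -> R) :
  (forall i, bounded_measurable (f i)) ->
  mean (fun w => \sum_(i <- r | p i) f i w) = \sum_(i <- r | p i) mean (f i).
Proof.
move=> bf; elim: r => [|i r IH].
  by under eq_fun do rewrite big_nil; rewrite mean_cst big_nil.
under eq_fun do rewrite big_cons; rewrite big_cons.
by case: (p i) => //; rewrite mean_add ?IH//; exact: bm_sum.
Qed.

Lemma mean_le f g : bounded_measurable f -> bounded_measurable g ->
  (forall w, f w <= g w) -> mean f <= mean g.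
Proof.
by move=> bf bg fg; apply: le_Rintegral => //; exact: bm_integrable.
Qed.

Lemma mean_norm_le f c : bounded_measurable f ->
  (forall w, `|f w| <= c) -> `|mean f| <= c.
Proof.
move=> bf fc; rewrite ler_norml; apply/andP; split.
  rewrite -[leLHS]mean_cst; apply: mean_le => //; first exact: bm_cst.
  by move=> w; move: (fc w); rewrite ler_norml => /andP[].
rewrite -[leRHS]mean_cst; apply: mean_le => //; first exact: bm_cst.
by move=> w; move: (fc w); rewrite ler_norml => /andP[].
Qed.

Lemma mean_indic (A : set T) : measurable A -> mean (\1_A : T -> R) = fine (P A).
Proof. by move=> mA; rewrite /mean_value /Rintegral integral_indic// setIT. Qed.

(* Uniform approximation of f by step functions of f reduces the claim to
   indicators. *)
Lemma mean_mul_indep f g : bounded_measurable f -> bounded_measurable g ->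
  (forall B : set R, measurable B ->
    mean (fun w => \1_(f @^-1` B) w * g w) = fine (P (f @^-1` B)) * mean g) ->
  mean (fun w => f w * g w) = mean f * mean g.
Proof.
move=> bf bg fg.
have [mf [c0 fc0]] := bf; have [mg [b0 gb0]] := bg.
pose b : R := `|b0| + 1.
have b0' : 0 < b by rewrite /b ltr_wpDl.
have gb w : `|g w| <= b.
  by apply: (le_trans (gb0 w)); rewrite (le_trans (ler_norm b0))// lerDl.
suff H k : `|mean (fun w => f w * g w) - mean f * mean g| <= 2 * b / k.+1%:R.
  apply/eqP; rewrite -subr_eq0 -normr_eq0 eq_le normr_ge0 andbT.
  apply/ler_addgt0Pr => e e0; rewrite add0r.
  have [k hk] := ltr_add_invr (divr_gt0 e0 (mulr_gt0 (ltr0Sn R 1) b0')).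
  rewrite add0r in hk.
  apply: (le_trans (H k)); rewrite ltW// mulrC -ltr_pdivlMr ?mulr_gt0//.
(* Bins of width [1 / k.+1]; the shift by the absolute value of [c0] makes their indices natural
   numbers. Below, [F] takes the left end of the bin that contains [f]. *)
pose B (i : nat) : set R := [set x | i%:R <= (x + `|c0|) * k.+1%:R /\ (x + `|c0|) * k.+1%:R < i.+1%:R].
have mB i : measurable (B i).
  rewrite (_ : B i = `[(i%:R / k.+1%:R - `|c0|), (i.+1%:R / k.+1%:R - `|c0|)[%classic); first exact: measurable_itv.
  apply/seteqP; split=> x /=; rewrite in_itv /=.
    by case=> h1 h2; rewrite lerBlDr ler_pdivrMr// h1/= ltrBrDr ltr_pdivlMr.
  by move=> /andP[]; rewrite lerBlDr ler_pdivrMr// ltrBrDr ltr_pdivlMr.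
have [N hN] : exists N : nat, 2 * `|c0| * k.+1%:R < N%:R.
  by exists (Num.truncn (2 * `|c0| * k.+1%:R)).+1; exact: truncnS_gt.
pose F w := \sum_(i < N) (i%:R / k.+1%:R - `|c0|) * \1_(f @^-1` B i) w.
have bBi i : bounded_measurable (\1_(f @^-1` B i) : T -> R).
  by apply: bm_indic; rewrite -[X in measurable X]setTI; exact: mf.
have bF : bounded_measurable F.
  by apply: bm_sum => i; apply: bm_mul => //; exact: bm_cst.
have fF w : `|f w - F w| <= k.+1%:R^-1.
  have fcw : 0 <= (f w + `|c0|) * k.+1%:R.
    rewrite mulr_ge0// -lerBlDr sub0r.
    by have := fc0 w; have := ler_norm c0; have := ler_norm (- f w); rewrite normrN; lra.
  have [i [i1 i2]] : exists i : nat, B i (f w).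
    exists (Num.truncn ((f w + `|c0|) * k.+1%:R)); split.
      by rewrite truncn_le.
    exact: truncnS_gt.
  have iN : (i < N)%N.
    rewrite -(ltr_nat R); apply: le_lt_trans i1 _; apply: le_lt_trans hN.
    rewrite ler_wpM2r//; have := fc0 w; have := ler_norm c0; have := ler_norm (f w); lra.
  have -> : F w = i%:R / k.+1%:R - `|c0|.
    rewrite /F (bigD1 (Ordinal iN))//= big1 => [|j ji].
      rewrite addr0 indicE mem_set ?mulr1//.
    rewrite indicE memNset ?mulr0// => -[/= j1 j2].
    move/eqP: ji; apply; apply/val_inj => /=.
    have := le_lt_trans i1 j2; have := le_lt_trans j1 i2.
    by rewrite !ltr_nat; lia.
  have k0 : (0 : R) < k.+1%:R by [].
  have -> : f w - (i%:R / k.+1%:R - `|c0|) = ((f w + `|c0|) * k.+1%:R - i%:R) / k.+1%:R.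
    by field; rewrite gt_eqF.
  rewrite normrM normfV (gtr0_norm k0) ler_pdivrMr// mulVf ?gt_eqF//.
  rewrite ger0_norm ?subr_ge0//; move: i2; rewrite -natr1; lra.
have FG : mean (fun w => F w * g w) = mean F * mean g.
  rewrite mean_sum => [|i]; last by apply: bm_mul => //; exact: bm_cst.
  under eq_fun do rewrite big_distrl /=.
  rewrite mean_sum => [|i]; last by do !apply: bm_mul => //; exact: bm_cst.
  rewrite big_distrl /=; apply: eq_bigr => i _.
  under eq_fun do rewrite -mulrA.
  rewrite mean_scale; last exact: bm_mul.
  rewrite fg// mean_scale// mean_indic ?mulrA//.
  by rewrite -[X in measurable X]setTI; exact: mf.
have bfF : bounded_measurable (fun w => f w - F w) by apply: bm_add => //; exact: bm_opp.
have -> : mean (fun w => f w * g w) - mean f * mean g =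
   mean (fun w => (f w - F w) * g w) - mean (fun w => f w - F w) * mean g.
  under [X in _ = mean X - _]eq_fun do rewrite mulrBl.
  rewrite mean_sub ?mean_sub ?FG//; [|exact: bm_mul|exact: bm_mul].
  by ring.
apply: (le_trans (ler_normB _ _)).
have -> : 2 * b / k.+1%:R = k.+1%:R^-1 * b + k.+1%:R^-1 * b :> R by ring.
apply: lerD.
  by apply: mean_norm_le => [|w]; [exact: bm_mul|rewrite normrM ler_pM].
rewrite normrM ler_pM//; [exact: mean_norm_le|exact: mean_norm_le].
Qed.

End BoundedMeasurable.

Section Independence.
Context (d : measure_display) (T : measurableType d) (R : realType).
Context (P : probability T R).

Lemma mean_prod_indic (I : finType) (D : {set I}) (G : I -> set_system T)
    (E : I -> set T) :
  mutually_independent P D G ->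
  (forall i, i \in D -> measurable (E i)) -> (forall i, i \in D -> G i (E i)) ->
  mean_value P (fun w => \prod_(i in D) \1_(E i) w) =
    \prod_(i in D) mean_value P (\1_(E i)).
Proof.
move=> ind mE GE.
have -> : (fun w => \prod_(i in D) \1_(E i) w) =
    \1_(\bigcap_(i in [set` D]) E i) :> (T -> R).
  apply/funext => w; rewrite [RHS]indicE.
  have [/set_mem Ew|/negP Ew] := boolP (w \in _).
    by rewrite big1// => i iD; rewrite indicE mem_set//; exact: Ew.
  have /existsNP[i /not_implyP[iD Eiw]] : ~ (forall i, i \in D -> E i w).
    by move=> h; apply: Ew; apply/mem_set => i /= iD; exact: h.
  by rewrite (bigD1 i)//= indicE memNset// mul0r.
rewrite mean_indic; last first.
  apply: fin_bigcap_measurable; first exact: finite_finset.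
  by move=> i /= iD; exact: mE.
rewrite ind//.
rewrite (eq_bigr (fun i => (fine (P (E i)))%:E)) => [|i iD]; last first.
  by rewrite fineK// fin_num_measure//; exact: mE.
rewrite prodEFin /=; apply: eq_bigr => i iD.
by rewrite mean_indic//; exact: mE.
Qed.

(* The functions are replaced by indicators one at a time. *)
Lemma mean_prod_indep (I : finType) (D : {set I}) (G : I -> set_system T)
    (f : I -> T -> R) :
  mutually_independent P D G ->
  (forall i, i \in D -> bounded_measurable (f i)) ->
  (forall i, i \in D -> forall B : set R, measurable B -> G i (f i @^-1` B)) ->
  mean_value P (fun w => \prod_(i in D) f i w) = \prod_(i in D) mean_value P (f i).
Proof.
move=> ind bf fG.
(* [A] contains the indices whose function is not yet known to be an indicator; the induction is on
   its size. *)
suff H k (A : {set I}) (g : I -> T -> R) : (#|A| <= k)%N ->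
    (forall i, i \in D -> bounded_measurable (g i)) ->
    (forall i, i \in D -> forall B : set R, measurable B -> G i (g i @^-1` B)) ->
    (forall i, i \in D -> i \notin A -> exists2 E, G i E & measurable E /\ g i = \1_E) ->
    mean_value P (fun w => \prod_(i in D) g i w) = \prod_(i in D) mean_value P (g i).
  by apply: (H #|I| [set: I]%SET) => // [|i _]; [exact: max_card|rewrite inE].
elim: k A g => [|k IH] A g cA bg gG gA.
  have {}gA i : exists E, i \in D -> [/\ G i E, measurable E & g i = \1_E].
    have [iD|] := boolP (i \in D); last by exists set0.
    have [|E GE [mE gE]] := gA i iD; last by exists E.
    by move: cA; rewrite leqn0 cards_eq0 => /eqP ->; rewrite inE.
  have [E hE] := choice gA.
  transitivity (mean_value P (fun w => \prod_(i in D) \1_(E i) w)).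
    by congr mean_value; apply/funext => w; apply: eq_bigr => i /hE[_ _ ->].
  rewrite (mean_prod_indic ind) => [|i /hE[]//|i /hE[]//].
  by apply: eq_bigr => i /hE[_ _ ->].
have [A0|[i0]] := set_0Vmem (A :&: D).
  apply: (IH (@finset.set0 I)) => //; first by rewrite cards0.
  move=> i iD _; apply: gA => //; apply/negP => iA.
  by have : i \in @finset.set0 I; [rewrite -A0 inE iA|rewrite inE].
rewrite inE => /andP[i0A i0D].
pose h (B : set R) i := if i == i0 then \1_(g i0 @^-1` B) else g i.
have mg B : measurable B -> measurable (g i0 @^-1` B).
  by move=> mB; rewrite -[X in measurable X]setTI; exact: (bg i0 i0D).1.
have hB B : measurable B ->
    mean_value P (fun w => \prod_(i in D) h B i w) = \prod_(i in D) mean_value P (h B i).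
  move=> mB; apply: (IH (A :\ i0)%SET).
  - by move: cA; rewrite (cardsD1 i0) i0A.
  - move=> i iD; rewrite /h; case: eqP => _; last exact: bg.
    by apply: bm_indic; exact: mg.
  - move=> i iD B' mB'; rewrite /h; case: eqP => [->|_]; last exact: gG.
    pose B'' : set R := [set x | B' (\1_B x)].
    rewrite (_ : _ @^-1` _ = g i0 @^-1` B''); first apply: gG => //.
      rewrite (_ : B'' = \1_B @^-1` B')// -[X in measurable X]setTI.
      exact: (measurable_indic mB).
    have e w : (w \in g i0 @^-1` B) = (g i0 w \in B).
      by apply/idP/idP => /set_mem ?; apply/mem_set.
    by apply/seteqP; split => w; rewrite /B'' /= !indicE e.
  - move=> i iD; rewrite !inE negb_and negbK /h; case: eqP => [->|_] /= h1.
      by exists (g i0 @^-1` B); [exact: gG|split => //; exact: mg].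
    exact: gA.
pose Q w := \prod_(i in D | i != i0) g i w.
have bQ : bounded_measurable Q.
  by apply: bm_prod => i /andP[iD _]; exact: bg.
have hBw B w : \prod_(i in D) h B i w = \1_(g i0 @^-1` B) w * Q w.
  rewrite (bigD1 i0)//= /h eqxx; congr (_ * _); apply: eq_bigr => i /andP[_].
  by move/negbTE ->.
have hBm B : \prod_(i in D) mean_value P (h B i) =
    mean_value P (\1_(g i0 @^-1` B)) * \prod_(i in D | i != i0) mean_value P (g i).
  rewrite (bigD1 i0)//= /h eqxx; congr (_ * _); apply: eq_bigr => i /andP[_].
  by move/negbTE ->.
(* For [B = setT] the factor at [i0] becomes 1, which leaves the product formula for the other
   factors. *)
have QE : mean_value P Q = \prod_(i in D | i != i0) mean_value P (g i).
  have := hB setT measurableT; rewrite hBm.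
  under [X in mean_value P X]eq_fun do rewrite hBw indicE preimage_setT in_setT mul1r.
  move->; rewrite preimage_setT indicT.
  by have := mean_cst P (1 : R); rewrite /cst => ->; rewrite mul1r.
have -> : (fun w => \prod_(i in D) g i w) = (fun w => g i0 w * Q w).
  by apply/funext => w; rewrite (bigD1 i0).
rewrite (bigD1 i0)//= -QE; apply: mean_mul_indep => //; first exact: bg.
move=> B mB; rewrite -mean_indic; last exact: mg.
by under [X in mean_value P X = _]eq_fun do rewrite -hBw; rewrite hB// hBm QE.
Qed.

End Independence.

(** * The noise entries *)

Lemma truncateE (R : realType) (x : R) : truncate x = Num.max (-1) (Num.min 1 x).
Proof. by rewrite /truncate maxEle minEle; do !case: ifP; lra. Qed.

Lemma truncate_norm (R : realType) (x : R) : `|truncate x| <= 1.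
Proof. by rewrite ler_norml /truncate; do !case: ifP; lra. Qed.

Lemma truncate_id (R : realType) (x : R) : `|x| <= 1 -> truncate x = x.
Proof. by rewrite ler_norml /truncate; do !case: ifP; lra. Qed.

Lemma measurable_truncate (R : realType) : measurable_fun setT (@truncate R).
Proof.
rewrite (_ : @truncate R = (cst (-1)) \max (cst 1 \min id)); last first.
  by apply/funext => x; rewrite truncateE.
by apply: measurable_maxr => //; apply: measurable_minr.
Qed.

Section DataMatrix.
Context (d : measure_display) (T : measurableType d) (R : realType).
Context (P : probability T R) (n : nat) (mo : data_model) (p : R) (M : 'M[R]_n).
Context (X : 'I_n * 'I_n -> {RV P >-> R}) (O : 'I_n * 'I_n -> {RV P >-> bool}).
Hypothesis dm : data_matrix mo p M X O.

Local Notation free := (free_entries mo n).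
Local Notation mean := (mean_value P).

Lemma bm_observed e : bounded_measurable (\1_(O e @^-1` [set true]) : T -> R).
Proof.
by apply: bm_indic; rewrite -[X in measurable X]setTI; exact: measurable_funPT.
Qed.

Lemma if_observedE e w (a b : R) : (if O e w then a else b) =
  \1_(O e @^-1` [set true]) w * a + (1 - \1_(O e @^-1` [set true]) w) * b.
Proof.
rewrite indicE; case: ifPn => Ow.
  by rewrite mem_set//=; ring.
by rewrite memNset//=; [ring|exact/negP].
Qed.

Lemma bm_if_observed e (f g : T -> R) : bounded_measurable f -> bounded_measurable g ->
  bounded_measurable (fun w => if O e w then f w else g w).
Proof.
move=> bf bg; under eq_fun do rewrite if_observedE.
have bO := bm_observed e; apply: bm_add; apply: bm_mul => //.
by apply: bm_add; [exact: bm_cst|exact: bm_opp].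
Qed.

Lemma bm_compX e (phi : R -> R) : bounded_measurable phi ->
  bounded_measurable (fun w => phi (X e w)).
Proof.
case=> mphi [c phic]; split; last by exists c.
exact: measurableT_comp.
Qed.

Lemma mean_observed e : e \in free -> mean (\1_(O e @^-1` [set true])) = p.
Proof.
move=> ef; rewrite mean_indic ?(data_observed dm ef)//.
by rewrite -[X in measurable X]setTI; exact: measurable_funPT.
Qed.

(** Each factor mixes [X e] and [O e], whereas independence concerns them separately. Splitting a
    factor into its observed and unobserved parts and distributing over all choices [f] gives
    products in which every factor depends on one sigma-algebra only. *)
Lemma mean_prod_entries (phi : 'I_n * 'I_n -> R -> R) (c : 'I_n * 'I_n -> R) :
  (forall e, bounded_measurable (phi e)) ->
  mean (fun w => \prod_(e in free) if O e w then phi e (X e w) else c e) =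
  \prod_(e in free) (p * mean (fun w => phi e (X e w)) + (1 - p) * c e).
Proof.
move=> bphi.
pose A (e : 'I_n * 'I_n) (t : bool) (w : T) : R :=
  if t then phi e (X e w) else c e.
pose B (e : 'I_n * 'I_n) (t : bool) (w : T) : R :=
  if t then \1_(O e @^-1` [set true]) w else 1 - \1_(O e @^-1` [set true]) w.
have bA e t : bounded_measurable (A e t).
  by rewrite /A; case: t; [exact: bm_compX|exact: bm_cst].
have bB e t : bounded_measurable (B e t).
  have bO := bm_observed e; rewrite /B; case: t => //.
  by apply: bm_add; [exact: bm_cst|exact: bm_opp].
have mA e : mean (A e true) = mean (fun w => phi e (X e w)) by [].
have mA0 e : mean (A e false) = c e by rewrite mean_cst.
have mB e : e \in free -> mean (B e true) = p by move=> ef; exact: mean_observed.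
have mB0 e : e \in free -> mean (B e false) = 1 - p.
  move=> ef; rewrite /B mean_sub ?mean_cst ?mean_observed//; first exact: bm_cst.
  exact: bm_observed.
transitivity (mean (fun w => \sum_(f in pfamily false (mem free) (fun=> predT))
    \prod_(e in free) (A e (f e) w * B e (f e) w))).
  congr mean_value; apply/funext => w.
  transitivity (\prod_(e in free) \sum_(t : bool) (A e t w * B e t w)).
    by apply: eq_bigr => e _; rewrite if_observedE big_bool /A /B /=; ring.
  exact: (big_distr_big_dep false).
rewrite mean_sum => [|f]; last by apply: bm_prod => e _; exact: bm_mul.
transitivity (\sum_(f in pfamily false (mem free) (fun=> predT))
    \prod_(e in free) (mean (A e (f e)) * mean (B e (f e)))); last first.
  transitivity (\prod_(e in free) \sum_(t : bool) (mean (A e t) * mean (B e t))).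
    by symmetry; exact: (big_distr_big_dep false).
  by apply: eq_bigr => e ef; rewrite big_bool mA mA0 mB// mB0//=; ring.
apply: eq_bigr => f _.
pose F (k : 'I_n * 'I_n + 'I_n * 'I_n) : T -> R :=
  match k with inl e => A e (f e) | inr e => B e (f e) end.
have ind := data_independent dm.
set D := (X in mutually_independent _ X _) in ind.
have bF k : bounded_measurable (F k) by case: k => e; [exact: bA|exact: bB].
have -> : (fun w => \prod_(e in free) (A e (f e) w * B e (f e) w)) =
    (fun w => \prod_(k in D) F k w).
  apply/funext => w; rewrite big_split /= big_sumType /=.
  by congr (_ * _); apply: eq_bigl => e; rewrite [RHS]inE.
transitivity (\prod_(k in D) mean (F k)); last first.
  by rewrite big_sumType big_split /=; congr (_ * _); apply: eq_bigl => e; rewrite [LHS]inE.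
apply: (mean_prod_indep (f := F) ind) => [//|].
(* The factor of an unobserved entry is constant, and preimages under constants are full or empty,
   hence members of every generated sigma-algebra. *)
have preim (A' : Type) (B' : set A') (Q : Prop) :
    [set _ : A' | Q] = setT \/ [set _ : A' | Q] = classical_sets.set0.
  by have [q|q] := pselect Q; [left|right]; apply/seteqP; split.
move=> [e|e] _ C mC /=.
  exists ([set x | C (if f e then phi e x else c e)]); last by rewrite setTI /F /A; case: (f e).
  case: (f e) => /=.
    by have [mphi _] := bphi e; rewrite -[X in measurable X]setTI; exact: mphi.
  by case: (preim R setT (C (c e))) => ->.
exists ([set b : bool | C (if f e then b%:R else 1 - b%:R)]) => //.
have e1 w : \1_(O e @^-1` [set true]) w = (O e w)%:R :> R.
  by have := if_observedE e w 1 0; rewrite mulr1 mulr0 addr0 => <-; case: (O e w).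
by rewrite setTI; apply/seteqP; split => w; rewrite /F /B /=; case: (f e); rewrite e1.
Qed.

Lemma mean_prod_entries_sub (K : {set 'I_n * 'I_n}) (phi : 'I_n * 'I_n -> R -> R)
    (c : 'I_n * 'I_n -> R) :
  K \subset free -> (forall e, bounded_measurable (phi e)) ->
  mean (fun w => \prod_(e in K) if O e w then phi e (X e w) else c e) =
  \prod_(e in K) (p * mean (fun w => phi e (X e w)) + (1 - p) * c e).
Proof.
move=> Kf bphi.
have sub (F : 'I_n * 'I_n -> R) :
    \prod_(e in free) (if e \in K then F e else 1) = \prod_(e in K) F e.
  rewrite -big_mkcondr; apply: eq_bigl => e.
  by apply/andP/idP => [[]//|eK]; split => //; exact: (fintype.subsetP Kf).
pose phi' e : R -> R := if e \in K then phi e else fun=> 1.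
pose c' e : R := if e \in K then c e else 1.
transitivity (mean (fun w => \prod_(e in free) if O e w then phi' e (X e w) else c' e)).
  congr mean_value; apply/funext => w; rewrite -[LHS]sub; apply: eq_bigr => e _.
  by rewrite /phi' /c'; case: (e \in K); case: (O e w).
rewrite mean_prod_entries => [|e]; last first.
  by rewrite /phi'; case: (e \in K) => //; exact: bm_cst.
rewrite -[RHS]sub; apply: eq_bigr => e _.
by rewrite /phi' /c'; case: (e \in K); rewrite // mean_cst; ring.
Qed.

Lemma mean_entry e (phi : R -> R) (c : R) : e \in free -> bounded_measurable phi ->
  mean (fun w => if O e w then phi (X e w) else c) =
  p * mean (fun w => phi (X e w)) + (1 - p) * c.
Proof.
move=> ef bphi.
have := @mean_prod_entries_sub [set e]%SET (fun=> phi) (fun=> c).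
rewrite finset.sub1set big_set1 => <- //.
by under [in RHS]eq_fun do rewrite big_set1.
Qed.

Lemma mean_prod_entries_on (K : {set 'I_n * 'I_n}) (phi : 'I_n * 'I_n -> R -> R)
    (c : 'I_n * 'I_n -> R) :
  K \subset free -> (forall e, bounded_measurable (phi e)) ->
  mean (fun w => \prod_(e in K) if O e w then phi e (X e w) else c e) =
  \prod_(e in K) mean (fun w => if O e w then phi e (X e w) else c e).
Proof.
move=> Kf bphi; rewrite mean_prod_entries_sub//; apply: eq_bigr => e eK.
by rewrite mean_entry//; exact: (fintype.subsetP Kf).
Qed.

(* The entry of Y - p M, truncated so as to be bounded everywhere and not only
   almost surely. *)
Definition noise (e : 'I_n * 'I_n) (w : T) : R :=
  (if O e w then truncate (X e w) else 0) - p * M e.1 e.2.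

Lemma bm_truncate : bounded_measurable (@truncate R).
Proof.
split; first exact: measurable_truncate.
by exists 1 => x; exact: truncate_norm.
Qed.

Lemma bm_noise e : bounded_measurable (noise e).
Proof.
apply: bm_add; last exact: bm_cst.
apply: bm_if_observed; last exact: bm_cst.
exact: bm_compX bm_truncate.
Qed.

Lemma mean_prod_noise (k : 'I_n * 'I_n -> nat) :
  mean (fun w => \prod_(e in free) noise e w ^+ k e) =
  \prod_(e in free) mean (fun w => noise e w ^+ k e).
Proof.
have E e w : noise e w ^+ k e = if O e w
    then (truncate (X e w) - p * M e.1 e.2) ^+ k e else (- (p * M e.1 e.2)) ^+ k e.
  by rewrite /noise; case: (O e w) => //; rewrite sub0r.
transitivity (mean (fun w => \prod_(e in free)
  if O e w then (truncate (X e w) - p * M e.1 e.2) ^+ k e else (- (p * M e.1 e.2)) ^+ k e)).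
  by congr mean_value; apply/funext => w; apply: eq_bigr => e _; rewrite E.
rewrite (mean_prod_entries_on (phi := fun e x => (truncate x - p * M e.1 e.2) ^+ k e)) //.
  by apply: eq_bigr => e _; congr mean_value; apply/funext => w; rewrite E.
by move=> e; apply: bm_exp; apply: bm_add; [exact: bm_truncate|exact: bm_cst].
Qed.

Hypotheses (p_ge0 : 0 <= p) (p_le1 : p <= 1).
Hypothesis M_le1 : forall i j, `|M i j| <= 1.

Lemma noise_le2 e w : `|noise e w| <= 2.
Proof.
apply: (le_trans (ler_normB _ _)); rewrite (_ : 2 = 1 + 1 :> R)//; apply: lerD.
  by case: ifP => _; [exact: truncate_norm|rewrite normr0].
by rewrite normrM ger0_norm// mulr_ile1.
Qed.

Lemma mean_truncate e : e \in free -> mean (fun w => truncate (X e w)) = M e.1 e.2.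
Proof.
move=> ef; rewrite /mean_value /Rintegral.
rewrite -(ae_eq_integral _ (fun w => (X e w)%:E)) //=.
- by have := data_mean dm e.1 e.2; rewrite -surjective_pairing unlock => ->.
- exact/measurable_EFinP.
- by apply/measurable_EFinP; apply: (bm_compX e bm_truncate).1.
- apply: filterS (data_bounded dm ef) => w Xw _ /=.
  by rewrite truncate_id.
Qed.

Lemma measurable_out_of_range e : measurable [set w | 1 < `|X e w|].
Proof.
rewrite (_ : [set w | _] = X e @^-1` [set x | 1 < `|x|]) // -[X in measurable X]setTI.
apply: measurable_funP => //.
rewrite (_ : [set x | _] = (@Num.norm _ R) @^-1` `]1, +oo[); last first.
  by apply/seteqP; split => x /=; rewrite in_itv/= andbT.
by rewrite -[X in measurable X]setTI; apply: normr_measurable.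
Qed.

Lemma prob_out_of_range e : e \in free -> mean (\1_[set w | 1 < `|X e w|]) = 0.
Proof.
move=> ef; have mB := measurable_out_of_range e; rewrite mean_indic//.
have := data_bounded dm ef; rewrite /almost_everywhere/= => -[N [mN N0 sub]].
rewrite (@subset_measure0 _ _ _ P _ N)//.
by move=> w /= Xw; apply: sub => /=; apply/negP; rewrite -ltNge.
Qed.

Lemma mean_noise e : e \in free -> mean (noise e) = 0.
Proof.
move=> ef; rewrite /noise mean_sub; last exact: bm_cst; last first.
  by apply: bm_if_observed; [exact: bm_compX bm_truncate|exact: bm_cst].
rewrite mean_cst mean_entry ?mean_truncate//; [ring|exact: bm_truncate].
Qed.

(** A variance is at most the second moment, here at most the probability [p] of observation. Having
    [p] and not a mere constant is what produces the level 4np in the trace moment. *)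
Lemma mean_noise_sq e : e \in free -> mean (fun w => noise e w ^+ 2) <= p.
Proof.
move=> ef; have btX := bm_compX e bm_truncate.
set a := p * M e.1 e.2.
have bO : bounded_measurable (fun w => if O e w then truncate (X e w) else 0).
  by apply: bm_if_observed => //; exact: bm_cst.
have -> : (fun w => noise e w ^+ 2) = (fun w =>
    (if O e w then truncate (X e w) ^+ 2 else 0) + (a ^+ 2 - 2 * a * (if O e w then truncate (X e w) else 0))).
  by apply/funext => w; rewrite /noise -/a; case: (O e w); ring.
have bO2 : bounded_measurable (fun w => if O e w then truncate (X e w) ^+ 2 else 0).
  by apply: bm_if_observed; [exact: bm_exp|exact: bm_cst].
have baO : bounded_measurable (fun w => 2 * a * (if O e w then truncate (X e w) else 0)).
  by apply: bm_mul => //; exact: bm_cst.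
rewrite mean_add//; last by apply: bm_add; [exact: bm_cst|exact: bm_opp].
rewrite mean_sub//; last exact: bm_cst.
rewrite mean_cst mean_scale// mean_entry ?mean_truncate//; last exact: bm_truncate.
have -> : a ^+ 2 - 2 * a * (p * M e.1 e.2 + (1 - p) * 0) = - a ^+ 2 by rewrite /a; ring.
have : mean (fun w => if O e w then truncate (X e w) ^+ 2 else 0) <= mean (\1_(O e @^-1` [set true])).
  apply: mean_le => //; first exact: bm_observed.
  move=> w; have := if_observedE e w 1 0; rewrite mulr1 mulr0 addr0 => <-.
  case: (O e w) => //; rewrite -real_normK ?num_real// expr_le1// truncate_norm//.
by rewrite mean_observed//; have := sqr_ge0 a; lra.
Qed.

(** The centred observation indicators are uncorrelated with second moments at most 1, so only the
    diagonal of the expanded square remains. *)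
Lemma mean_proportion_sq : (0 < #|free|)%N ->
  mean (fun w => (observed_proportion mo O w - p) ^+ 2) <= #|free|%:R^-1.
Proof.
move=> f0; have F0 : (0 : R) < #|free|%:R by rewrite ltr0n.
pose z e w : R := if O e w then 1 - p else - p.
have bz e : bounded_measurable (z e) by apply: bm_if_observed; exact: bm_cst.
have zE w : observed_proportion mo O w - p = #|free|%:R^-1 * \sum_(e in free) z e w.
  have -> : \sum_(e in free) z e w = \sum_(e in free) ((O e w)%:R - p).
    by apply: eq_bigr => e _; rewrite /z; case: (O e w); rewrite ?sub0r.
  rewrite big_split /= sumr_const -natr_sum mulrDr mulNrn mulrN -[p *+ _]mulr_natl mulKf ?gt_eqF//.
  congr (_ - _); rewrite /observed_proportion mulrC; congr (_ * _%:R).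
  rewrite -sum1dep_card big_mkcondr; apply: eq_bigr => e _; by case: (O e w).
have zz e f : e \in free -> f \in free ->
    mean (fun w => z e w * z f w) <= (e == f)%:R.
  move=> ef ff; have [->|nef] := eqVneq e f.
    rewrite -[leRHS](mean_cst P); apply: mean_le; [exact: bm_mul|exact: bm_cst|].
    by move=> w; rewrite /z mulr1n; case: (O f w); rewrite ?mulrNN mulr_ile1// ?subr_ge0// gerBl.
  have := @mean_prod_entries_on [set e; f]%SET (fun=> fun=> 1 - p) (fun=> - p).
  rewrite big_setU1 ?inE//= big_set1 => H.
  have -> : (fun w => z e w * z f w) = (fun w => \prod_(i in [set e; f]%SET) z i w).
    by apply/funext => w; rewrite big_setU1 ?inE//= big_set1.
  rewrite H; last by move=> _; exact: bm_cst.
    have -> := mean_entry (phi := fun=> 1 - p) (- p) ef (bm_cst _ _).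
    by rewrite mean_cst (_ : p * (1 - p) + (1 - p) * - p = 0) ?mul0r//; ring.
  by apply/fintype.subsetP => g; rewrite !inE => /orP[]/eqP->; move: ef ff; rewrite !inE.
have -> : (fun w => (observed_proportion mo O w - p) ^+ 2) =
    (fun w => #|free|%:R^-1 ^+ 2 * \sum_(e in free) \sum_(f in free) z e w * z f w).
  apply/funext => w; rewrite zE exprMn; congr (_ * _).
  by rewrite expr2 big_distrl; apply: eq_bigr => e _; rewrite big_distrr.
have bzz e f : bounded_measurable (fun w => z e w * z f w) by exact: bm_mul.
rewrite mean_scale; last by apply: bm_sum => e; exact: bm_sum.
rewrite mean_sum => [|e]; last exact: bm_sum.
under eq_bigr => e _ do rewrite mean_sum//.
have : \sum_(e in free) \sum_(f in free) mean (fun w => z e w * z f w) <= #|free|%:R.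
  apply: (@le_trans _ _ (\sum_(e in free) \sum_(f in free) (e == f)%:R)).
    by apply: ler_sum => e ef; apply: ler_sum => f ff; exact: zz.
  rewrite -sum1_card natr_sum; apply: ler_sum => e ef.
  by rewrite (bigD1 e)//= eqxx big1 ?addr0// => f /andP[_ /negbTE]; rewrite eq_sym => ->.
move=> S; apply: (@le_trans _ _ (#|free|%:R^-1 ^+ 2 * #|free|%:R)).
  by rewrite ler_wpM2l// exprn_ge0// invr_ge0.
by rewrite expr2 -mulrA mulVf ?mulr1// gt_eqF.
Qed.

End DataMatrix.

(** * Closed walks *)

Section Words.
Variable A : eqType.
Implicit Types h s : seq A.

(** Marks the steps that meet a letter for the first time, given the history [h]. It is applied both
    to the vertices and to the edges of a walk. *)
Fixpoint fresh h s : seq bool :=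
  if s is y :: s' then (y \notin h) :: fresh (y :: h) s' else [::].

Lemma size_fresh h s : size (fresh h s) = size s.
Proof. by elim: s h => //= y s IH h; rewrite IH. Qed.

Lemma size_undup_catrev s h :
  size (undup (catrev s h)) = (count id (fresh h s) + size (undup h))%N.
Proof.
elim: s h => //= y s IH h; rewrite IH /=; case: (y \in h) => //=; lia.
Qed.

Lemma sum_count_undup s : \sum_(e <- undup s) count_mem e s = size s.
Proof.
transitivity (\sum_(e <- undup s) \sum_(x <- s | x == e) 1)%N.
  by apply: eq_bigr => e _; rewrite sum1_count; apply: eq_count.
rewrite -[RHS]sum1_size (exchange_big_dep xpredT)//= [RHS]big_seq [LHS]big_seq; apply: eq_bigr => x xs.
rewrite (eq_bigl (fun e => e == x)) => [|e]; last by rewrite eq_sym.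
by rewrite sum1_count count_uniq_mem ?undup_uniq// mem_undup xs.
Qed.

(** Every letter present occurs at least twice, and there are at least half as many letters as
    positions, so no position is left for a third occurrence. *)
Lemma count_eq2 s : (forall e, count_mem e s != 1) ->
  (size s <= (size (undup s)).*2)%N -> forall e, (count_mem e s <= 2)%N.
Proof.
move=> c1 sz e; have [es|/count_memPn -> //] := boolP (e \in s).
have c2 x : x \in s -> (2 <= count_mem x s)%N.
  by rewrite -has_pred1 has_count; have := c1 x; lia.
move: sz; rewrite -sum_count_undup (bigD1_seq e) ?mem_undup ?undup_uniq//=.
have -> : (size (undup s)).*2 = (2 + \sum_(i <- undup s | i != e) 2)%N.
  rewrite -(bigD1_seq e (F := fun=> 2%N)) ?mem_undup ?undup_uniq//=.
  by rewrite big_const_seq count_predT iter_addn_0 mul2n.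
move=> sz; rewrite -(leq_add2r (\sum_(i <- undup s | i != e) 2)).
apply: leq_trans sz; rewrite leq_add2l.
rewrite big_seq_cond [leqRHS]big_seq_cond; apply: leq_sum => i /andP[].
by rewrite mem_undup => /c2.
Qed.

End Words.

Fixpoint words (A : finType) (l : nat) : seq (seq A) :=
  if l is l'.+1 then [seq x :: s | x <- enum A, s <- words A l'] else [:: [::]].

Lemma mem_words (A : finType) (s : seq A) : s \in words A (size s).
Proof.
elim: s => //= x s IH; apply/allpairsP; exists (x, s) => /=; split => //.
by rewrite mem_enum.
Qed.

Lemma big_words (S : Type) (idx : S) (op : Monoid.com_law idx) (A : finType) l (F : seq A -> S) :
  \big[op/idx]_(s <- words A l.+1) F s =
  \big[op/idx]_x \big[op/idx]_(s <- words A l) F (x :: s).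
Proof. by rewrite /= big_allpairs_dep big_enum. Qed.

Lemma size_words (A : finType) l (s : seq A) : s \in words A l -> size s = l.
Proof.
elim: l s => [|l IH] s /=; first by rewrite inE => /eqP ->.
by move=> /allpairsP[[x t] /= [_ /IH <- ->]].
Qed.

Lemma card_words (A : finType) l : size (words A l) = (#|A| ^ l)%N.
Proof. by elim: l => //= l IH; rewrite size_allpairs IH expnS -cardE. Qed.

(** Each step either repeats one of at most [m] earlier letters or introduces a new one, at the cost
    of one of the available factors [#|V|]. These are at most [m.+1] alternatives per step. *)
Lemma few_letters (V : finType) (m l : nat) (h : seq V) : (0 < #|V|)%N ->
  (size (undup h) <= m)%N ->
  (\sum_(s <- words V l) (size (undup (catrev s h)) <= m) <=
     #|V| ^ (m - size (undup h)) * m.+1 ^ l)%N.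
Proof.
move=> V0; elim: l h => [|l IH] h hm.
  by rewrite big_seq1 /= hm muln1 expn_gt0 V0.
rewrite big_words (bigID (mem (undup h))) /= expnS.
set k := size (undup h); set K := (#|V| ^ (m - k) * m.+1 ^ l)%N.
rewrite [leqRHS](_ : _ = m * K + K)%N; last by rewrite mulnCA mulSnr.
apply: leq_add.
  apply: (@leq_trans (\sum_(x in undup h) K)%N).
    apply: leq_sum => x; rewrite mem_undup => xh.
    by have := IH (x :: h); rewrite /= xh => /(_ hm).
  rewrite sum_nat_const leq_mul2r; apply/orP; right.
  by rewrite (card_uniqP _) ?undup_uniq.
have [km|km] := ltnP k m; last first.
  rewrite big1 // => x; rewrite mem_undup => xh; rewrite big1 // => s _.
  by rewrite /= size_undup_catrev /= (negbTE xh) /= -/k; case: leqP => //; lia.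
apply: (@leq_trans (\sum_(x : V) #|V| ^ (m - k.+1) * m.+1 ^ l)%N); last first.
  by rewrite sum_nat_const mulnA -expnS /K -subSn// subSS.
rewrite big_mkcond; apply: leq_sum => x _; case: ifPn => //; rewrite mem_undup => xh.
by have := IH (x :: h); rewrite /= (negbTE xh) => /(_ km).
Qed.

(** * Walks on a graph whose undirected edges are named by [key], with [None] for a missing edge *)

Section Walks.
Context (V : finType) (E : eqType) (key : V -> V -> option E).
Hypothesis keyC : forall x y, key x y = key y x.
Hypothesis key_inj : forall x y x' y', key x y != None -> key x y = key x' y' ->
  x' = x /\ y' = y \/ x' = y /\ y' = x.

Lemma mem_pairmap x s e : e \in pairmap key x s ->
  exists a b, [/\ a \in x :: s, b \in x :: s & e = key a b].
Proof.
elim: s x => //= y s IH x; rewrite inE => /orP[/eqP ->|/IH[a [b [ha hb ->]]]].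
  by exists x, y; rewrite !inE !eqxx orbT.
by exists a, b; split=> //; rewrite inE ?ha ?hb orbT.
Qed.

(** The invariant linking used edges to visited vertices: since a used edge has both ends in [h], a
    step to an unvisited vertex must use a new edge. *)
Definition spanned (h : seq V) (es : seq (option E)) :=
  forall e, e \in es -> exists a b, [/\ a \in h, b \in h & e = key a b].

Lemma spanned_cons x y h es : x \in h -> spanned h es ->
  spanned (y :: h) (key x y :: es).
Proof.
move=> xh sp e; rewrite inE => /orP[/eqP ->|/sp[a [b [ha hb ->]]]].
  by exists x, y; rewrite !inE xh eqxx orbT.
by exists a, b; rewrite !inE ha hb !orbT.
Qed.

Lemma spanned_fresh x y h es : key x y != None -> spanned h es -> y \notin h ->
  key x y \notin es.
Proof.
move=> kn sp; apply: contra => /sp[a [b [ha hb /(key_inj kn)]]].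
by case=> -[ea eb]; [rewrite -eb|rewrite -ea].
Qed.

Lemma fresh_le s x h es : x \in h -> spanned h es -> None \notin pairmap key x s ->
  (count id (fresh h s) <= count id (fresh es (pairmap key x s)))%N.
Proof.
elim: s x h es => //= y s IH x h es xh sp; rewrite inE negb_or eq_sym => /andP[kn ks].
apply: leq_add; last by apply: IH => //; [exact: mem_head|exact: spanned_cons].
have [//|yh] := boolP (y \in h).
by rewrite (spanned_fresh kn sp yh).
Qed.

(* [st] is the tree path from the current vertex back to the root: a true bit
   pushes a neighbour, a false bit pops. *)
Fixpoint replay (b : bitseq) (x : V) (st s : seq V) : bool :=
  match b, s with
  | [::], [::] => true
  | true :: b', y :: s' => (key x y != None) && replay b' y (x :: st) s'
  | false :: b', y :: s' =>
      if st is z :: st' then (y == z) && replay b' z st' s' else false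
  | _, _ => false
  end.

(** Here [h] is the list of visited vertices and [es] that of used edges. The invariant [once] says
    that an edge used exactly once so far lies on the path from [x] to the root. A step to an old
    vertex then traverses such an edge for the second time, and therefore goes back to the
    parent. *)
Lemma replay_fresh s x st h es :
  uniq (x :: st) -> {subset x :: st <= h} -> spanned h es ->
  (forall e, count_mem e es = 1%N -> e \in pairmap key x st) ->
  (forall e, count_mem e (es ++ pairmap key x s) <= 2)%N ->
  None \notin pairmap key x s ->
  (count id (fresh es (pairmap key x s)) <= count id (fresh h s))%N ->
  replay (fresh h s) x st s.
Proof.
elim: s x st h es => //= y s IH x st h es /andP[xst ust] sub sp once c2.
rewrite inE negb_or eq_sym => /andP[kn ks] le.
have xh : x \in h by apply: sub; exact: mem_head.
have sp' := spanned_cons (y := y) xh sp.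
have c2' e : (count_mem e ((key x y :: es) ++ pairmap key y s) <= 2)%N.
  by have := c2 e; rewrite !count_cat /=; lia.
have le' := fresh_le (mem_head y h) sp' ks.
have [yh|yh] /= := boolP (y \in h).
  have le2 : (count id (fresh (key x y :: es) (pairmap key y s)) <=
      count id (fresh (y :: h) s))%N by move: le; rewrite yh /=; lia.
  (* Otherwise this step would add a fresh edge without a fresh vertex, and the remaining steps,
     which by [fresh_le] have at least as many fresh edges as fresh vertices, could not
     compensate. *)
  have kes : key x y \in es.
    by apply: contraT => kes; move: le le'; rewrite yh kes /=; lia.
  have /once : count_mem (key x y) es = 1%N.
    have : (0 < count_mem (key x y) es)%N by rewrite -has_count has_pred1.
    have := c2 (key x y); rewrite count_cat.
    by move: (count_mem _ es) => c; rewrite /= eqxx; lia.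
  case: st xst ust sub once => // z st; rewrite inE negb_or => /andP[xz xst] ust sub once.
  (* The path is simple, so [x] is an end of its first edge only; the edge just used leads to
     [z]. *)
  rewrite [pairmap _ _ _]/= inE => /orP[/eqP kxz|/mem_pairmap[a [b [ha hb /(key_inj kn)]]]]; last first.
    by case=> -[ea eb]; [move: ha|move: hb]; rewrite ?ea ?eb inE (negbTE xz) (negbTE xst).
  have yz : y = z.
    have [[_ ->]//|[_ ezx]] := key_inj kn kxz.
    by rewrite ezx eqxx in xz.
  subst z; rewrite eqxx /=; apply: (IH y st (y :: h) (key x y :: es)) => //.
    by move=> a ha; rewrite inE sub ?orbT// inE ha orbT.
  move=> e; have [->|ne] := eqVneq e (key x y).
    have : (0 < count_mem (key x y) es)%N by rewrite -has_count has_pred1.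
    by rewrite [count_mem _ (_ :: _)]/= eqxx => c0 [] /= c1; rewrite add0n in c1; rewrite c1 in c0.
  rewrite /= eq_sym (negbTE ne) add0n => /once.
  by rewrite inE (negbTE ne).
rewrite kn /=; apply: IH => //.
- apply/andP; split; last exact/andP.
  by apply/negP => /sub; exact/negP.
- by move=> a; rewrite !inE => /orP[->//|ha]; rewrite sub ?orbT// inE.
- exact: sp'.
- move=> e; have [-> _|ne] := eqVneq e (key x y).
    by rewrite /= inE [key y x]keyC eqxx.
  rewrite [count_mem _ (_ :: _)]/= eq_sym (negbTE ne) add0n => /once ei.
  by rewrite inE ei orbT.
- by move: le; rewrite (spanned_fresh kn sp yh) yh /=; lia.
Qed.

End Walks.

Section WalkSums.
Context (V : finType) (E : eqType) (key : V -> V -> option E).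
Hypothesis keyC : forall x y, key x y = key y x.
Hypothesis key_inj : forall x y x' y', key x y != None -> key x y = key x' y' ->
  x' = x /\ y' = y \/ x' = y /\ y' = x.
Context (dg : nat).
Hypothesis degree : forall x, (#|[pred y | key x y != None]| <= dg)%N.

(** Only a true bit leaves a choice, among at most [dg] neighbours; a false bit forces the return to
    the top of the stack. *)
Lemma replay_count b x st :
  (\sum_(s <- words V (size b)) replay key b x st s <= dg ^ count id b)%N.
Proof.
elim: b x st => [|[] b IH] x st; first by rewrite big_seq1.
  rewrite [size _]/= big_words /= expnS.
  apply: (@leq_trans (\sum_(y in [pred y | key x y != None]) dg ^ count id b)%N); last first.
    by rewrite sum_nat_const leq_mul2r degree orbT.
  rewrite big_mkcond [leqRHS]big_mkcond; apply: leq_sum => y _; rewrite inE.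
  by case: (key x y != None) => /=; [exact: IH|rewrite big1].
rewrite [size _]/= big_words /= add0n.
case: st => [|z st]; first by rewrite big1// => y _; rewrite big1.
rewrite (bigD1 z)//= eqxx [X in (_ + X)%N]big1 ?addn0 /=; first exact: IH.
by move=> y /negbTE yz; rewrite big1// => s _; rewrite yz.
Qed.

(* A step to a new vertex uses a new edge, and there are at most m edges as each
   is used twice or more; so if more than m vertices are met, each step to an old
   vertex uses an old edge, and each edge is used exactly twice. *)
Lemma replayable x s m : size s = m.*2 -> None \notin pairmap key x s ->
  (forall e, count_mem e (pairmap key x s) != 1%N) ->
  (m < size (undup (catrev s [:: x])))%N ->
  [/\ forall e, e \in pairmap key x s -> count_mem e (pairmap key x s) = 2%N,
      replay key (fresh [:: x] s) x [::] s & (count id (fresh [:: x] s) <= m)%N].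
Proof.
move=> sz nN c1; rewrite size_undup_catrev /= addn1 ltnS => mle.
have sp : @spanned V E key [:: x] [::] by [].
have le := fresh_le key_inj (mem_head x [::]) sp nN.
have first_undup : count id (fresh [::] (pairmap key x s)) = size (undup (pairmap key x s)).
  have := size_undup_catrev (pairmap key x s) [::]; rewrite /= addn0 => <-.
  by apply: perm_size; apply: perm_undup => e; rewrite catrevE cats0 mem_rev.
have c2 e : (count_mem e (pairmap key x s) <= 2)%N.
  apply: count_eq2 => //; rewrite size_pairmap sz -first_undup leq_double.
  exact: leq_trans le.
have dbl : (size (undup (pairmap key x s)) <= m)%N.
  rewrite -leq_double -sz -(size_pairmap key x) -[leqRHS]sum_count_undup -muln2.
  rewrite -(count_predT (undup _)) -sum1_count big_distrl /= big_seq [leqRHS]big_seq.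
  apply: leq_sum => e; rewrite mem_undup mul1n -has_pred1 has_count.
  by have := c1 e; case: (count_mem e _) => [|[]].
split; last by rewrite -first_undup in dbl; exact: leq_trans le dbl.
  move=> e; rewrite -has_pred1 has_count.
  by have := c1 e; have := c2 e; case: (count_mem e _) => [|[|[]]].
apply: (replay_fresh keyC key_inj (es := [::])) => //.
by rewrite first_undup (leq_trans dbl).
Qed.

(** Walks with at most [m] distinct vertices are bounded by [c] and counted by [few_letters]. The
    others that contribute are bounded by [v] and determined by a starting point, a bit word with at
    most [m] true bits and the choices counted by [replay_count]. *)
Lemma sum_walks (R : realType) (m : nat) (c v : R) (f : V -> seq V -> R) :
  (0 < m)%N -> (0 < #|V|)%N -> (0 < dg)%N -> 0 <= c -> 0 <= v ->
  (forall x s, size s = m.*2 -> f x s <= c) ->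
  (forall x s, None \in pairmap key x s -> f x s <= 0) ->
  (forall x s e, count_mem e (pairmap key x s) = 1%N -> f x s <= 0) ->
  (forall x s, size s = m.*2 -> None \notin pairmap key x s ->
    (forall e, e \in pairmap key x s -> count_mem e (pairmap key x s) = 2%N) ->
    f x s <= v) ->
  \sum_x \sum_(s <- words V m.*2) f x s <=
    c * (#|V| ^ m * m.+1 ^ m.*2)%:R + v * (#|V| * (4 * dg) ^ m)%:R.
Proof.
move=> m0 V0 d0 c0 v0 fc fN f1 f2.
pose few (x : V) s : nat := (size (undup (catrev s [:: x])) <= m)%N.
pose rp x s : nat := (\sum_(b <- words bool m.*2 | count id b <= m) replay key b x [::] s)%N.
have bound x s : size s = m.*2 -> f x s <= c * (few x s)%:R + v * (rp x s)%:R.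
  move=> sz; have [nN|nN] := boolP (None \in pairmap key x s).
    by apply: (le_trans (fN _ _ nN)); rewrite addr_ge0// mulr_ge0.
  have [[e c1]|/forallNP c1] := pselect (exists e, count_mem e (pairmap key x s) = 1%N).
    by apply: (le_trans (f1 _ _ _ c1)); rewrite addr_ge0// mulr_ge0.
  have [fw|fw] := leqP (size (undup (catrev s [:: x]))) m.
    by rewrite /few fw mulr1 (le_trans (fc x s sz))// lerDl mulr_ge0.
  have c1' e : count_mem e (pairmap key x s) != 1%N by apply/eqP; exact: c1.
  have [c2 rep cm] := replayable sz nN c1' fw.
  apply: (le_trans (f2 x s sz nN c2)); rewrite /few leqNgt fw mulr0 add0r.
  have fm : fresh [:: x] s \in [seq b <- words bool m.*2 | (count id b <= m)%N].
    by rewrite mem_filter cm -sz -(size_fresh [:: x]) mem_words.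
  by rewrite ler_peMr// ler1n /rp -big_filter (big_rem _ fm) /= rep.
apply: (@le_trans _ _ (\sum_x \sum_(s <- words V m.*2) (c * (few x s)%:R + v * (rp x s)%:R))).
  apply: ler_sum => x _; rewrite big_seq [leRHS]big_seq; apply: ler_sum => s /size_words.
  exact: bound.
under eq_bigr => x _ do rewrite big_split -!big_distrr /= -!natr_sum.
rewrite big_split -!big_distrr /= -!natr_sum; apply: lerD.
  rewrite ler_wpM2l// ler_nat.
  (* The starting vertex already is one of the at most [m] letters, hence the exponent [m.-1];
     summing over it restores [m]. *)
  apply: (@leq_trans (\sum_(x : V) #|V| ^ m.-1 * m.+1 ^ m.*2)%N).
    by apply: leq_sum => x _; rewrite -subn1; apply: few_letters.
  by rewrite sum_nat_const mulnA -expnS prednK.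
rewrite ler_wpM2l// ler_nat.
rewrite -sum_nat_const; apply: leq_sum => x _.
rewrite /rp exchange_big /=.
(* The number of bit words, 2 to the power 2m, supplies the 4 in [4 * dg]. *)
apply: (@leq_trans (\sum_(b <- words bool m.*2) dg ^ m)%N); last first.
  by rewrite big_const_seq count_predT iter_addn_0 card_words card_bool expnMn -mul2n expnM mulnC.
rewrite big_mkcond big_seq [leqRHS]big_seq; apply: leq_sum => b /size_words bs.
case: ifP => // bm; rewrite -bs; apply: (leq_trans (replay_count b x [::])).
by rewrite leq_pexp2l.
Qed.

End WalkSums.

(** * The trace moment *)

Lemma expr_mx_walks (R : pzRingType) N (B : 'M[R]_N) l x y :
  (B ^+ l) x y = \sum_(s <- words 'I_N l)
    (last x s == y)%:R * \prod_(b <- pairmap B x s) b.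
Proof.
elim: l x => [|l IH] x; first by rewrite expr0 big_seq1 big_nil mulr1 mxE.
rewrite exprS mxE big_words; apply: eq_bigr => z _.
rewrite IH big_distrr /=; apply: eq_bigr => s _; rewrite big_cons.
by case: (_ == y); rewrite ?mul1r// !mul0r mulr0.
Qed.

Lemma prod_count (R : comPzSemiRingType) (E : finType) (D : {set E}) (z : E -> R)
    (ks : seq (option E)) : (forall k, k \in ks -> exists2 e, e \in D & k = Some e) ->
  \prod_(k <- ks) oapp z 0 k = \prod_(e in D) z e ^+ count_mem (Some e) ks.
Proof.
elim: ks => [|k ks IH] kD.
  by rewrite big_nil big1// => e _; rewrite expr0.
have [e0 eD ke] := kD k (mem_head _ _); subst k.
rewrite big_cons IH => [|k kk]; last by apply: kD; rewrite inE kk orbT.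
under [RHS]eq_bigr do rewrite [count_mem _ _]/= exprD.
rewrite big_split /=; congr (_ * _).
rewrite (bigD1 e0)//= eqxx expr1 big1 ?mulr1// => e /andP[_ /negbTE ne].
by rewrite (inj_eq Some_inj) eq_sym ne expr0.
Qed.

Section TraceMoment.
Context (d : measure_display) (T : measurableType d) (R : realType).
Context (P : probability T R) (n : nat) (mo : data_model) (p : R) (M : 'M[R]_n).
Context (X : 'I_n * 'I_n -> {RV P >-> R}) (O : 'I_n * 'I_n -> {RV P >-> bool}).
Hypothesis dm : data_matrix mo p M X O.
Hypotheses (p_ge0 : 0 <= p) (p_le1 : p <= 1).
Hypothesis M_le1 : forall i j, `|M i j| <= 1.

Local Notation free := (free_entries mo n).
Local Notation mean := (mean_value P).
Local Notation noise := (noise p M X O).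

Context (N : nat) (key : 'I_N -> 'I_N -> option ('I_n * 'I_n)).
Hypothesis keyC : forall x y, key x y = key y x.
Hypothesis key_inj : forall x y x' y', key x y != None -> key x y = key x' y' ->
  x' = x /\ y' = y \/ x' = y /\ y' = x.
Hypothesis degree : forall x, (#|[pred y | key x y != None]| <= n)%N.
Hypothesis key_free : forall x y e, key x y = Some e -> e \in free.

Definition noise_mx (w : T) : 'M[R]_N :=
  \matrix_(x, y) oapp (fun e => noise e w) 0 (key x y).

Definition walk_noise x s (w : T) : R :=
  \prod_(k <- pairmap key x s) oapp (fun e => noise e w) 0 k.

Lemma bm_walk_noise x s : bounded_measurable (walk_noise x s).
Proof.
apply: bm_prod => -[e|] _ /=; [exact: bm_noise|exact: bm_cst].
Qed.

Lemma trace_noise_mx l w : \tr (noise_mx w ^+ l) =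
  \sum_x \sum_(s <- words 'I_N l) (last x s == x)%:R * walk_noise x s w.
Proof.
apply: eq_bigr => x _; rewrite expr_mx_walks; apply: eq_bigr => s _; congr (_ * _).
rewrite /walk_noise; move: x; elim: s => [|y s IH] x /=; rewrite ?big_nil//.
by rewrite !big_cons IH mxE.
Qed.

Lemma bm_trace_noise_mx l : bounded_measurable (fun w => \tr (noise_mx w ^+ l)).
Proof.
under eq_fun do rewrite trace_noise_mx.
do 2! apply: bm_sum => ?; apply: bm_mul; [exact: bm_cst|exact: bm_walk_noise].
Qed.

Lemma key_walk x s k : None \notin pairmap key x s -> k \in pairmap key x s ->
  exists2 e, e \in free & k = Some e.
Proof.
move=> nN ks; have [a [b [_ _ kE]]] := mem_pairmap ks.
case: k ks kE => [e|] ks kE; last by rewrite ks in nN.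
by exists e => //; exact: (key_free (esym kE)).
Qed.

Lemma mean_walk_noise x s : None \notin pairmap key x s ->
  mean (walk_noise x s) =
  \prod_(e in free) mean (fun w => noise e w ^+ count_mem (Some e) (pairmap key x s)).
Proof.
move=> nN; rewrite -(mean_prod_noise dm).
congr mean_value; apply/funext => w; rewrite /walk_noise (prod_count (D := free))//.
by move=> k; exact: key_walk.
Qed.

(** The trace is expanded over closed walks. Independence and centring kill a walk with an edge used
    exactly once; a walk using each of its edges twice has mean at most [p ^+ m]; for the walks with
    few vertices the crude bound 2 per step suffices. *)
Lemma trace_moment m : (0 < m)%N -> (0 < n)%N -> (0 < N)%N ->
  mean (fun w => \tr (noise_mx w ^+ m.*2)) <=
    2 ^+ m.*2 * (N ^ m * m.+1 ^ m.*2)%:R + p ^+ m * (N * (4 * n) ^ m)%:R.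
Proof.
move=> m0 n0 N0.
under eq_fun do rewrite trace_noise_mx.
have bm x s : bounded_measurable (fun w => (last x s == x)%:R * walk_noise x s w).
  by apply: bm_mul; [exact: bm_cst|exact: bm_walk_noise].
rewrite mean_sum => [|x]; last exact: bm_sum.
under eq_bigr => x _ do rewrite mean_sum//.
rewrite -[N in X in _ <= X]card_ord; apply: (sum_walks keyC key_inj degree) => //.
- by rewrite card_ord.
- exact: exprn_ge0.
- move=> x s sz; apply: le_trans (ler_norm _) _; apply: mean_norm_le => // w.
  rewrite normrM -[leRHS]mul1r ler_pM//; first by case: eqP; rewrite ?normr1 ?normr0.
  rewrite -sz -(size_pairmap key x) /walk_noise; elim: (pairmap key x s) => [|k ks IH].
    by rewrite big_nil normr1.
  rewrite big_cons normrM exprS ler_pM//.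
  by case: k => [e|] /=; rewrite ?normr0//; exact: noise_le2.
- move=> x s nN; rewrite (_ : (fun w => _) = cst 0) ?mean_cst//.
  apply/funext => w; rewrite /walk_noise (big_rem _ nN) /=; ring.
- move=> x s e c1; have [nN|nN] := boolP (None \in pairmap key x s).
    rewrite (_ : (fun w => _) = cst 0) ?mean_cst//.
    by apply/funext => w; rewrite /walk_noise (big_rem _ nN) /=; ring.
  rewrite mean_scale ?mean_walk_noise//; last exact: bm_walk_noise.
  have [e0 ef ee] : exists2 e0, e0 \in free & e = Some e0.
    by apply: (key_walk nN); rewrite -has_pred1 has_count c1.
  rewrite (bigD1 e0)//= -ee c1; under eq_fun do rewrite expr1.
  by rewrite (mean_noise dm)// mul0r mulr0.
- move=> x s sz nN c2; rewrite mean_scale ?mean_walk_noise//; last exact: bm_walk_noise.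
  set Q := \prod_(e in free) _.
  (* Each step is charged [Num.sqrt p]: an edge used twice then receives the bound [p] of its second
     moment, and the 2m steps together give [p ^+ m]. *)
  have Q0 e : e \in free ->
     0 <= mean (fun w => noise e w ^+ count_mem (Some e) (pairmap key x s)) <=
     Num.sqrt p ^+ count_mem (Some e) (pairmap key x s).
    move=> ef; have [es|/count_memPn ->] := boolP (Some e \in pairmap key x s); last first.
      by under eq_fun do rewrite expr0; rewrite mean_cst ler01 lexx.
    rewrite c2// sqr_sqrtr// (mean_noise_sq dm)// andbT -[leLHS](mean_cst P).
    by apply: mean_le => [||w]; [exact: bm_cst|exact/bm_exp/bm_noise|exact: sqr_ge0].
  apply: (@le_trans _ _ Q).
    rewrite ler_piMl//; last by case: eqP.
    by apply: prodr_ge0 => e /Q0/andP[].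
  apply: (@le_trans _ _ (\prod_(e in free) Num.sqrt p ^+ count_mem (Some e) (pairmap key x s))).
    by apply: ler_prod => e; exact: Q0.
  rewrite -prod_count => [|k]; last exact: key_walk.
  rewrite big_seq (eq_bigr (fun=> Num.sqrt p)) => [|k /(key_walk nN)[e _ ->]//].
  rewrite -big_seq big_const_seq count_predT iter_mulr_1 size_pairmap sz.
  by rewrite -mul2n exprM sqr_sqrtr.
Qed.

End TraceMoment.

(** * Matrix inequalities *)

Section FrobeniusProduct.
Variable R : realType.

Definition fdot m n (A B : 'M[R]_(m, n)) : R := \sum_i \sum_j A i j * B i j.

Lemma fdotC m n (A B : 'M[R]_(m, n)) : fdot A B = fdot B A.
Proof. by do 2! apply: eq_bigr => ? _; rewrite mulrC. Qed.

Lemma fdotDl m n (A B C : 'M[R]_(m, n)) : fdot (A + B) C = fdot A C + fdot B C.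
Proof.
rewrite -big_split; apply: eq_bigr => i _; rewrite -big_split.
by apply: eq_bigr => j _; rewrite mxE mulrDl.
Qed.

Lemma fdotDr m n (A B C : 'M[R]_(m, n)) : fdot A (B + C) = fdot A B + fdot A C.
Proof. by rewrite fdotC fdotDl !(fdotC A). Qed.

Lemma fdotZl m n a (A B : 'M[R]_(m, n)) : fdot (a *: A) B = a * fdot A B.
Proof.
rewrite big_distrr /=; apply: eq_bigr => i _; rewrite big_distrr /=.
by apply: eq_bigr => j _; rewrite mxE mulrA.
Qed.

Lemma fdotZr m n a (A B : 'M[R]_(m, n)) : fdot A (a *: B) = a * fdot A B.
Proof. by rewrite fdotC fdotZl fdotC. Qed.

Lemma fdotNl m n (A B : 'M[R]_(m, n)) : fdot (- A) B = - fdot A B.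
Proof. by rewrite -scaleN1r fdotZl mulN1r. Qed.

Lemma fdotNr m n (A B : 'M[R]_(m, n)) : fdot A (- B) = - fdot A B.
Proof. by rewrite fdotC fdotNl fdotC. Qed.

Lemma fdot0l m n (B : 'M[R]_(m, n)) : fdot 0 B = 0.
Proof. by rewrite -(scale0r 0) fdotZl mul0r. Qed.

Lemma fdot_suml m n I (r : seq I) (S : pred I) (F : I -> 'M[R]_(m, n)) B :
  fdot (\sum_(i <- r | S i) F i) B = \sum_(i <- r | S i) fdot (F i) B.
Proof.
exact: (big_morph (fun A => fdot A B) (fun x y => fdotDl x y B) (fdot0l B)).
Qed.

Lemma fdot_sumr m n I (r : seq I) (S : pred I) (F : I -> 'M[R]_(m, n)) B :
  fdot B (\sum_(i <- r | S i) F i) = \sum_(i <- r | S i) fdot B (F i).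
Proof. by rewrite fdotC fdot_suml; apply: eq_bigr => i _; rewrite fdotC. Qed.

Lemma fdot_ge0 m n (A : 'M[R]_(m, n)) : 0 <= fdot A A.
Proof. by do 2! apply: sumr_ge0 => ? _; rewrite -expr2 sqr_ge0. Qed.

Lemma fdot_sqr_le m n (A B : 'M[R]_(m, n)) :
  fdot A B ^+ 2 <= fdot A A * fdot B B.
Proof.
have q t : 0 <= fdot A A - 2 * t * fdot A B + t ^+ 2 * fdot B B.
  have := fdot_ge0 (A - t *: B).
  by rewrite fdotDl !fdotDr !fdotNl !fdotNr !fdotZl !fdotZr (fdotC B A); congr (_ <= _); ring.
have := fdot_ge0 B; rewrite le_eqVlt => /orP[/eqP B0|B0].
  rewrite -B0 mulr0; have [->|AB] := eqVneq (fdot A B) 0; first by rewrite expr0n.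
  (* With no quadratic term left, [q] is affine in its argument, and this value makes it -1. *)
  have := q ((fdot A A + 1) / (2 * fdot A B)).
  rewrite -B0 mulr0 (_ : _ - _ + 0 = -1); last by field.
  by rewrite ler0N1.
have := q (fdot A B / fdot B B).
rewrite (_ : _ + _ = fdot A A - fdot A B ^+ 2 / fdot B B); last by field; rewrite gt_eqF.
by rewrite subr_ge0 ler_pdivrMr.
Qed.

Lemma fdot_norm_le m n (A B : 'M[R]_(m, n)) a b : 0 <= a -> 0 <= b ->
  fdot A A <= a ^+ 2 -> fdot B B <= b ^+ 2 -> `|fdot A B| <= a * b.
Proof.
move=> a0 b0 Aa Bb; rewrite -(ler_pXn2r (n := 2))// ?nnegrE ?mulr_ge0//.
rewrite real_normK ?num_real// (le_trans (fdot_sqr_le _ _))// exprMn.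
by rewrite ler_pM// fdot_ge0.
Qed.

Lemma bessel (I : finType) m n (S : pred I) (F : I -> 'M[R]_(m, n)) B :
  (forall i j, fdot (F i) (F j) = (i == j)%:R) ->
  \sum_(i | S i) fdot (F i) B ^+ 2 <= fdot B B.
Proof.
move=> on; pose C := \sum_(i | S i) fdot (F i) B *: F i.
have FC i : S i -> fdot (F i) C = fdot (F i) B.
  move=> Si; rewrite /C fdot_sumr (bigD1 i)//= fdotZr on eqxx mulr1 big1 ?addr0//.
  by move=> j /andP[_ ji]; rewrite fdotZr on eq_sym (negbTE ji) mulr0.
have CB : fdot C B = \sum_(i | S i) fdot (F i) B ^+ 2.
  by rewrite /C fdot_suml; apply: eq_bigr => i _; rewrite fdotZl expr2.
have CC : fdot C C = \sum_(i | S i) fdot (F i) B ^+ 2.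
  by rewrite {1}/C fdot_suml; apply: eq_bigr => i Si; rewrite fdotZl FC ?expr2.
have := fdot_ge0 (B - C).
by rewrite fdotDl !fdotDr !fdotNl !fdotNr (fdotC B C) CC CB; lra.
Qed.

Lemma fdot_outer m n (x : 'cV[R]_m) (y : 'cV[R]_n) A :
  fdot (x *m y^T) A = fdot x (A *m y).
Proof.
apply: eq_bigr => i _; rewrite big_ord1 mxE big_distrr /=; apply: eq_bigr => j _.
by rewrite mxE big_ord1 mxE /=; ring.
Qed.

Lemma fdot_mulmx m n k (x : 'M[R]_(m, k)) (A : 'M[R]_(m, n)) (y : 'M[R]_(n, k)) :
  fdot x (A *m y) = fdot (A^T *m x) y.
Proof.
rewrite /fdot.
under eq_bigr => i _ do under eq_bigr => j _ do rewrite mxE big_distrr /=.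
under [RHS]eq_bigr => i _ do under eq_bigr => j _ do rewrite mxE big_distrl /=.
under [RHS]eq_bigr => i _ do rewrite exchange_big.
rewrite [RHS]exchange_big /=; apply: eq_bigr => i _; rewrite exchange_big /=.
by do 2! apply: eq_bigr => ? _; rewrite mxE; ring.
Qed.

Lemma fdot_outer2 m n (x x' : 'cV[R]_m) (y y' : 'cV[R]_n) :
  fdot (x *m y^T) (x' *m y'^T) = fdot x x' * fdot y y'.
Proof.
rewrite fdot_outer -mulmxA (_ : y'^T *m y = (fdot y y')%:M).
  by rewrite mul_mx_scalar fdotZr mulrC.
rewrite [LHS]mx11_scalar; congr (_%:M); rewrite mxE; apply: eq_bigr => i _.
by rewrite big_ord1 mxE mulrC.
Qed.

(** Bessel's inequality for each row of [A]. *)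
Lemma sum_fdot_mulmx_le (I : finType) m n (S : pred I) (A : 'M[R]_(m, n))
    (y : I -> 'cV[R]_n) :
  (forall i j, fdot (y i) (y j) = (i == j)%:R) ->
  \sum_(i | S i) fdot (A *m y i) (A *m y i) <= fdot A A.
Proof.
move=> on; rewrite /fdot exchange_big /=; apply: ler_sum => r _.
have -> : \sum_j A r j * A r j = fdot (row r A)^T (row r A)^T.
  by apply: eq_bigr => j _; rewrite big_ord1 !mxE.
apply: le_trans (bessel S _ on); apply: ler_sum => i _.
rewrite big_ord1 -expr2 le_eqVlt; apply/orP; left; apply/eqP; congr (_ ^+ 2).
by rewrite mxE; apply: eq_bigr => j _; rewrite big_ord1 !mxE mulrC.
Qed.

Lemma trace_gram n (A : 'M[R]_n) : A^T = A -> \tr (A *m A) = fdot A A.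
Proof.
move=> sA; rewrite -{1}sA mxtrace_mulC; apply: eq_bigr => i _.
by rewrite mxE; apply: eq_bigr => j _; rewrite mxE.
Qed.

Lemma sym_exp n (A : 'M[R]_n) k : A^T = A -> (A ^+ k)^T = A ^+ k.
Proof.
move=> sA; elim: k => [|k IH]; first by rewrite expr0 trmx1.
by rewrite {1}exprS -[LHS]/((A *m A ^+ k)^T) trmx_mul IH sA exprSr.
Qed.

(* Cauchy-Schwarz, iterated j times. *)
Lemma quad_pow_le n (A : 'M[R]_n) (y : 'cV[R]_n) j : A^T = A ->
  fdot y (A *m y) ^+ (2 ^ j) <=
  fdot y y ^+ (2 ^ j).-1 * fdot y (A ^+ (2 ^ j) *m y).
Proof.
elim: j A => [|j IH] A sA; first by rewrite expn0 expr1 expr0 mul1r expr1.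
have step : fdot y (A *m y) ^+ 2 <= fdot y y * fdot y (A ^+ 2 *m y).
  apply: le_trans (fdot_sqr_le _ _) _.
  by rewrite expr2 -[A * A]/(A *m A) -mulmxA [fdot y (A *m _)]fdot_mulmx sA.
rewrite expnS exprM exprM.
apply: (@le_trans _ _ ((fdot y y * fdot y (A ^+ 2 *m y)) ^+ (2 ^ j))).
  by rewrite lerXn2r// ?nnegrE ?sqr_ge0// (le_trans _ step)// sqr_ge0.
rewrite exprMn; have := IH (A ^+ 2) (sym_exp 2 sA).
move=> /(ler_wpM2l (exprn_ge0 (2 ^ j) (fdot_ge0 y))) /le_trans; apply.
rewrite mulrA -exprD (_ : (2 ^ j + (2 ^ j).-1)%N = (2 * 2 ^ j).-1)//.
by have := expn_gt0 2 j; lia.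
Qed.

(** One Cauchy-Schwarz step removes [x] and leaves the quadratic form of [A ^+ 2] at [y], to which
    [quad_pow_le] applies. The right-hand side ends in a squared norm, so that it can be summed over
    an orthonormal family. *)
Lemma bilinear_pow_le n (A : 'M[R]_n) (x y : 'cV[R]_n) j : A^T = A ->
  fdot x (A *m y) ^+ (2 ^ j).*2 <=
  fdot x x ^+ (2 ^ j) * (fdot y y ^+ (2 ^ j).-1 *
    fdot (A ^+ (2 ^ j) *m y) (A ^+ (2 ^ j) *m y)).
Proof.
move=> sA; rewrite -mul2n exprM.
have step : fdot x (A *m y) ^+ 2 <= fdot x x * fdot y (A ^+ 2 *m y).
  apply: le_trans (fdot_sqr_le _ _) _.
  by rewrite expr2 -[A * A]/(A *m A) -mulmxA [fdot y (A *m _)]fdot_mulmx sA.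
apply: (@le_trans _ _ ((fdot x x * fdot y (A ^+ 2 *m y)) ^+ (2 ^ j))).
  by rewrite lerXn2r// ?nnegrE ?sqr_ge0// (le_trans _ step)// sqr_ge0.
rewrite exprMn ler_wpM2l ?exprn_ge0 ?fdot_ge0//.
apply: le_trans (quad_pow_le y j (sym_exp 2 sA)) _.
by rewrite -exprM mulnC exprM expr2 -[X in fdot y (X *m y)]/(A ^+ (2 ^ j) *m A ^+ (2 ^ j)) -mulmxA fdot_mulmx sym_exp.
Qed.

Lemma sum_bilinear_pow_le (I : finType) (S : pred I) n (A : 'M[R]_n)
    (x y : I -> 'cV[R]_n) j : A^T = A -> (forall i, fdot (x i) (x i) = 1) ->
  (forall i k, fdot (y i) (y k) = (i == k)%:R) ->
  \sum_(i | S i) fdot (x i) (A *m y i) ^+ (2 ^ j).*2 <= \tr (A ^+ (2 ^ j).*2).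
Proof.
move=> sA x1 on.
rewrite -addnn exprD -[X in \tr X]/(A ^+ (2 ^ j) *m A ^+ (2 ^ j)) trace_gram ?sym_exp//.
apply: le_trans (sum_fdot_mulmx_le S _ on); apply: ler_sum => i _.
rewrite addnn; apply: le_trans (bilinear_pow_le _ _ _ sA) _.
by rewrite x1 on eqxx !expr1n !mul1r.
Qed.

(** Replaces the bound of the operator norm by a trace: the Frobenius norm of [A ^+ (2 ^ j)]
    dominates its action on [y]. *)
Lemma bilinear_trace_le n (A : 'M[R]_n) (x y : 'cV[R]_n) j : A^T = A ->
  fdot x (A *m y) ^+ (2 ^ j).*2 <=
  (fdot x x * fdot y y) ^+ (2 ^ j) * \tr (A ^+ (2 ^ j).*2).
Proof.
move=> sA; apply: le_trans (bilinear_pow_le _ _ _ sA) _.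
rewrite exprMn -mulrA ler_wpM2l ?exprn_ge0 ?fdot_ge0//.
rewrite -[X in _ <= _ ^+ X * _]prednK ?expn_gt0// exprSr -mulrA.
rewrite ler_wpM2l ?exprn_ge0 ?fdot_ge0//.
rewrite -addnn exprD -[X in \tr X]/(A ^+ (2 ^ j) *m A ^+ (2 ^ j)) trace_gram ?sym_exp//.
set B := A ^+ _.
(* |B y|^2 <= |y|^2 |B|_F^2, row by row *)
rewrite {1}/fdot [fdot B B]/fdot big_distrr /=; apply: ler_sum => i _.
rewrite big_ord1 -expr2.
have -> : (B *m y) i 0 = fdot y (row i B)^T.
  by rewrite mxE; apply: eq_bigr => k _; rewrite big_ord1 !mxE mulrC.
apply: le_trans (fdot_sqr_le _ _) _.
rewrite ler_wpM2l ?fdot_ge0// /fdot; apply: ler_sum => k _.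
by rewrite big_ord1 !mxE.
Qed.

End FrobeniusProduct.

(** * Deterministic bound for the thresholded matrix *)

(** If [b] exceeds [t], multiplying it by an odd power of [b / t] only increases it. Summed over
    indices, this charges the values above [t] to a high even moment. *)
Lemma ler_pow_threshold (R : realType) (b t : R) k : 0 < t ->
  b <= t + b ^+ k.*2.+2 / t ^+ k.*2.+1.
Proof.
move=> t0; have [bt|tb] := leP b t.
  rewrite (le_trans bt)// lerDl divr_ge0//; last exact/exprn_ge0/ltW.
  by apply: exprn_even_ge0; rewrite /= negbK odd_double.
rewrite ler_wpDl ?(ltW t0)// ler_pdivlMr ?exprn_gt0// [leRHS]exprS.
have b0 := lt_trans t0 tb.
by rewrite ler_wpM2l ?(ltW b0)// lerXn2r// ?nnegrE ?(ltW b0) ?(ltW t0) ?(ltW tb).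
Qed.

Lemma sqr_pow_threshold (R : realType) (b t : R) k : 0 < t ->
  b ^+ 2 <= t ^+ 2 + b ^+ k.*2.+2 / t ^+ k.*2.
Proof.
move=> t0; have [bt|tb] := leP (b ^+ 2) (t ^+ 2).
  rewrite (le_trans bt)// lerDl divr_ge0//; last exact/exprn_ge0/ltW.
  by apply: exprn_even_ge0; rewrite /= negbK odd_double.
rewrite ler_wpDl ?sqr_ge0// ler_pdivlMr ?exprn_gt0//.
have -> : b ^+ k.*2.+2 = b ^+ 2 * b ^+ k.*2 by rewrite -exprD.
by rewrite ler_wpM2l ?sqr_ge0// -mul2n !exprM lerXn2r// ?nnegrE ?sqr_ge0// ltW.
Qed.

Section Deterministic.
Context (R : realType) (n : nat) (eta p ph : R).
Context (Y M : 'M[R]_n) (U V : 'M[R]_n) (s : 'I_n -> R).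
Hypotheses (eta_gt0 : 0 < eta) (eta_lt1 : eta < 1) (n_gt0 : (0 < n)%N).
Hypotheses (p_gt0 : 0 < p) (p_le1 : p <= 1) (ph_le1 : ph <= 1).
Hypothesis ph_close : p * (1 - eta / 6) <= ph.
Hypothesis svd : is_svd Y U s V.
Hypothesis Y_le1 : forall i j, `|Y i j| <= 1.
Hypothesis M_le1 : forall i j, `|M i j| <= 1.

Context (r : nat) (x z : 'I_r -> 'cV[R]_n) (D : 'M[R]_n) (eps : R).
Hypothesis eps_ge0 : 0 <= eps.
Hypothesis M_split : M = \sum_a x a *m (z a)^T + D.
Hypothesis x_le : forall a, fdot (x a) (x a) <= n%:R.
Hypothesis z_le : forall a, fdot (z a) (z a) <= n%:R.
Hypothesis D_le : fdot D D <= (eps * n%:R) ^+ 2.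

Local Notation E := (Y - p *: M).
Local Notation u i := (col i U).
Local Notation v i := (col i V).
Local Notation b i := (fdot (u i) (E *m v i)).
Local Notation sn := (Num.sqrt (n%:R : R)).
Local Notation t := ((2 + eta) * Num.sqrt (n%:R * ph)).
Local Notation t1 := ((2 + eta / 4) * Num.sqrt (n%:R * p)).

Context (k : nat) (omega gamma : R).
Hypotheses (omega_ge0 : 0 <= omega) (gamma_ge0 : 0 <= gamma).
Hypothesis noise_sum : forall S : pred 'I_n,
  \sum_(i | S i) b i ^+ k.*2.+2 <= omega * n%:R * t1 ^+ k.*2.+2.
Hypothesis noise_bilinear : forall y y' : 'cV[R]_n,
  fdot y y <= n%:R -> fdot y' y' <= n%:R -> `|fdot y (E *m y')| <= gamma * n%:R ^+ 2.

Local Notation S := (fun i => t <= s i).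
Let F i := u i *m (v i)^T.
Let Yh := \sum_(i | S i) s i *: F i.
Let Rm := \sum_(i | ~~ S i) s i *: F i.

Let n0 : 0 < n%:R :> R. Proof. by rewrite ltr0n. Qed.
Let sn0 : 0 < sn. Proof. by rewrite sqrtr_gt0. Qed.
Let snn : sn ^+ 2 = n%:R. Proof. by rewrite sqr_sqrtr// ltW. Qed.

Lemma col_orthonormal (B : 'M[R]_n) i j : B^T *m B = 1%:M ->
  fdot (col i B) (col j B) = (i == j)%:R.
Proof.
move=> BB; have := congr1 (fun A : 'M[R]_n => A i j) BB; rewrite !mxE => <-.
by apply: eq_bigr => k' _; rewrite big_ord1 !mxE.
Qed.

Lemma left_orthonormal i j : fdot (u i) (u j) = (i == j)%:R.
Proof. exact: col_orthonormal (svd_left svd). Qed.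

Lemma right_orthonormal i j : fdot (v i) (v j) = (i == j)%:R.
Proof. exact: col_orthonormal (svd_right svd). Qed.

Lemma rank1_orthonormal i j : fdot (F i) (F j) = (i == j)%:R.
Proof. by rewrite fdot_outer2 left_orthonormal right_orthonormal; case: eqP => _; rewrite ?mulr1 ?mulr0. Qed.

Lemma fdot_F_sum (Q : pred 'I_n) (c c' : 'I_n -> R) :
  fdot (\sum_(i | Q i) c i *: F i) (\sum_(i | Q i) c' i *: F i) =
  \sum_(i | Q i) c i * c' i.
Proof.
rewrite fdot_suml; apply: eq_bigr => i Qi; rewrite fdotZl; congr (_ * _).
rewrite fdot_sumr (bigD1 i)//= fdotZr rank1_orthonormal eqxx mulr1 big1 ?addr0// => j /andP[_ ji].
by rewrite fdotZr rank1_orthonormal eq_sym (negbTE ji) mulr0.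
Qed.

Lemma Y_split : Y = Yh + Rm.
Proof. by rewrite (svd_sum svd) (bigID S). Qed.

Lemma fdot_Yh_Rm : fdot Yh Rm = 0.
Proof.
rewrite fdot_suml big1// => i Si; rewrite fdot_sumr big1// => j Sj.
rewrite fdotZl fdotZr rank1_orthonormal (_ : (i == j) = false) ?mulr0//.
by apply: contraNF Sj => /eqP <-.
Qed.

Lemma entries_le m1 m2 (B : 'M[R]_(m1, m2)) c : (forall i j, `|B i j| <= c) ->
  fdot B B <= m1%:R * m2%:R * c ^+ 2.
Proof.
move=> Bc; apply: (@le_trans _ _ (\sum_(i < m1) \sum_(j < m2) c ^+ 2)).
  apply: ler_sum => i _; apply: ler_sum => j _.
  have c0 := le_trans (normr_ge0 _) (Bc i j).
  by rewrite -expr2 -real_normK ?num_real// lerXn2r// nnegrE.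
by rewrite !sumr_const !card_ord -mulrnA mulnC -[leLHS]mulr_natl natrM.
Qed.

Lemma fdot_observed_le : fdot Y Y <= n%:R ^+ 2.
Proof. by apply: le_trans (entries_le Y_le1) _; rewrite expr1n mulr1 expr2. Qed.

Lemma fdot_kept_le : fdot Yh Yh <= n%:R ^+ 2.
Proof.
apply: le_trans fdot_observed_le; rewrite [in leRHS]Y_split fdotDl !fdotDr [fdot Rm Yh]fdotC fdot_Yh_Rm.
by rewrite addr0 add0r lerDl fdot_ge0.
Qed.

Lemma fdot_dropped_le : fdot Rm Rm <= n%:R ^+ 2.
Proof.
apply: le_trans fdot_observed_le; rewrite [in leRHS]Y_split fdotDl !fdotDr [fdot Rm Yh]fdotC fdot_Yh_Rm.
by rewrite addr0 add0r lerDr fdot_ge0.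
Qed.

Lemma fdot_noise_le : fdot E E <= (2 * n%:R) ^+ 2.
Proof.
apply: le_trans (entries_le (c := 2) _) _ => [i j|]; last by rewrite le_eqVlt; apply/orP; left; apply/eqP; ring.
rewrite !mxE (le_trans (ler_normB _ _))// (_ : 2 = 1 + 1 :> R)// lerD//.
by rewrite normrM (ger0_norm (ltW p_gt0)) mulr_ile1// ltW.
Qed.

(* Bessel for the families u and v, after 2|ab| <= a^2 + b^2. *)
Lemma rank1_sum_le (Q : pred 'I_n) (c : 'I_n -> R) (y y' : 'cV[R]_n) w : 0 <= w ->
  (forall i, Q i -> 0 <= c i <= w) -> fdot y y <= n%:R -> fdot y' y' <= n%:R ->
  `|fdot (\sum_(i | Q i) c i *: F i) (y *m y'^T)| <= w * n%:R.
Proof.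
move=> w0 cw yn yn'.
rewrite fdot_suml; apply: (le_trans (ler_norm_sum _ _ _)).
apply: (@le_trans _ _ (w / 2 * (\sum_(i | Q i) fdot (u i) y ^+ 2 + \sum_(i | Q i) fdot (v i) y' ^+ 2))).
  rewrite -big_split big_distrr; apply: ler_sum => i Qi /=.
  have /andP[c0 c1] := cw i Qi.
  rewrite fdotZl fdot_outer2 normrM ger0_norm//.
  have h : `|fdot (u i) y * fdot (v i) y'| <= (fdot (u i) y ^+ 2 + fdot (v i) y' ^+ 2) / 2.
    rewrite ler_norml; have := sqr_ge0 (fdot (u i) y + fdot (v i) y').
    by have := sqr_ge0 (fdot (u i) y - fdot (v i) y'); lra.
  apply: (le_trans (ler_pM _ _ c1 h)) => //.
  by rewrite le_eqVlt; apply/orP; left; apply/eqP; field.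
have B1 := le_trans (bessel Q y left_orthonormal) yn; have B2 := le_trans (bessel Q y' right_orthonormal) yn'.
by rewrite -mulrA ler_wpM2l// ler_pdivrMl//; lra.
Qed.

(** The threshold uses the observed proportion [ph], which may be below [p]. A relative deficit of
    [eta / 6] is tolerable because [(2 + eta / 2) ^+ 2] is at most [(2 + eta) ^+ 2 * (1 - eta / 6)]
    for [eta] in (0,1). *)
Lemma threshold_gap : eta / 4 * Num.sqrt (n%:R * p) <= t - t1.
Proof.
have e0 := eta_gt0; have e1 := eta_lt1.
suff : (2 + eta / 2) * Num.sqrt (n%:R * p) <= t by lra.
have e2 : 0 <= 2 + eta / 2 by lra.
have e3 : 0 <= 2 + eta by lra.
have np0 : 0 <= n%:R * p by rewrite mulr_ge0// ltW.
rewrite -(ler_pXn2r (n := 2))// ?nnegrE ?mulr_ge0 ?sqrtr_ge0// !exprMn.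
have ph0 : 0 <= ph by apply: le_trans ph_close; rewrite mulr_ge0 ?(ltW p_gt0)//; lra.
rewrite !sqr_sqrtr ?(mulr_ge0 _ ph0)// mulrCA [leRHS]mulrCA ler_pM2l//.
have h : (2 + eta / 2) ^+ 2 <= (2 + eta) ^+ 2 * (1 - eta / 6).
  have h1 : 0 <= eta * (1 - eta) by rewrite mulr_ge0; lra.
  have h2 : 0 <= eta * (eta * (1 - eta)) by rewrite mulr_ge0; lra.
  lra.
apply: (@le_trans _ _ ((2 + eta) ^+ 2 * (1 - eta / 6) * p)); first by rewrite ler_pM2r.
by rewrite -mulrA ler_wpM2l ?sqr_ge0// mulrC.
Qed.

Lemma t1_gt0 : 0 < t1.
Proof.
rewrite mulr_gt0//; first by have := eta_gt0; lra.
by rewrite sqrtr_gt0 mulr_gt0.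
Qed.

Lemma t_le : t <= 3 * sn.
Proof.
have e0 := eta_gt0; have e1 := eta_lt1.
apply: ler_pM; rewrite ?sqrtr_ge0//; [lra|lra|].
by rewrite ler_sqrt// ler_piMr.
Qed.

Lemma t1_le : t1 <= 3 * sn.
Proof.
have e0 := eta_gt0; have e1 := eta_lt1.
apply: ler_pM; rewrite ?sqrtr_ge0//; [lra|lra|].
by rewrite ler_sqrt// ler_piMr.
Qed.

Lemma fdot_F_E i : fdot (F i) E = b i. Proof. exact: fdot_outer. Qed.

Lemma fdot_F_Y i : fdot (F i) Y = s i.
Proof.
rewrite (svd_sum svd) fdot_sumr (bigD1 i)//= fdotZr rank1_orthonormal eqxx mulr1 big1 ?addr0//.
by move=> j ji; rewrite fdotZr rank1_orthonormal eq_sym (negbTE ji) mulr0.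
Qed.

Let q : R := \sum_(i | S i) 1.

Lemma kept_le_n : q <= n%:R.
Proof.
rewrite /q big_mkcond (@le_trans _ _ (\sum_(i < n) 1))//.
  by apply: ler_sum => i _; case: ifP.
by rewrite sumr_const card_ord.
Qed.

Lemma sum_b_le : \sum_(i | S i) b i <= q * t1 + omega * n%:R * t1.
Proof.
apply: (@le_trans _ _ (\sum_(i | S i) (1 * t1 + b i ^+ k.*2.+2 / t1 ^+ k.*2.+1))).
  by apply: ler_sum => i _; rewrite mul1r ler_pow_threshold// t1_gt0.
rewrite big_split -!big_distrl /= lerD2l ler_pdivrMr ?exprn_gt0 ?t1_gt0//.
by apply: le_trans (noise_sum _) _; rewrite exprS !mulrA.
Qed.

Lemma sum_b2_le : \sum_(i | S i) b i ^+ 2 <= (q + omega * n%:R) * t1 ^+ 2.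
Proof.
apply: (@le_trans _ _ (\sum_(i | S i) (1 * t1 ^+ 2 + b i ^+ k.*2.+2 / t1 ^+ k.*2))).
  by apply: ler_sum => i _; rewrite mul1r sqr_pow_threshold// t1_gt0.
rewrite big_split -!big_distrl /= [leRHS]mulrDl lerD2l ler_pdivrMr ?exprn_gt0 ?t1_gt0//.
by apply: le_trans (noise_sum _) _; rewrite -[k.*2.+2]/(2 + k.*2)%N exprD !mulrA.
Qed.

(** The [r] rank-one pieces of [M] are handled by Bessel and only see the largest coefficient; the
    remainder [D] is handled by Cauchy-Schwarz and sees the root of the sum of squares. *)
Lemma sum_F_M_le (Q : pred 'I_n) (c : 'I_n -> R) w e :
  0 <= w -> 0 <= e -> (forall i, Q i -> 0 <= c i <= w) ->
  \sum_(i | Q i) c i ^+ 2 <= e ^+ 2 ->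
  `|fdot (\sum_(i | Q i) c i *: F i) M| <= r%:R * (w * n%:R) + e * (eps * n%:R).
Proof.
move=> w0 e0 cw ce; rewrite [in X in fdot _ X]M_split fdotDr fdot_sumr (le_trans (ler_normD _ _))//.
apply: lerD.
  apply: le_trans (ler_norm_sum _ _ _) _.
  apply: (@le_trans _ _ (\sum_(a < r) w * n%:R)); last by rewrite sumr_const card_ord mulr_natl.
  by apply: ler_sum => a _; exact: rank1_sum_le.
apply: fdot_norm_le => //; first by rewrite mulr_ge0.
by rewrite fdot_F_sum; under eq_bigr do rewrite -expr2.
Qed.

Lemma kept_bound : q * (eta / 4 * Num.sqrt (n%:R * p)) <=
  n%:R * (r%:R + eps * sn + 3 * omega * sn).
Proof.
have H : q * t <= \sum_(i | S i) s i.
  by rewrite /q big_distrl; apply: ler_sum => i Si /=; rewrite mul1r.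
have e1 : \sum_(i | S i) s i = p * fdot (\sum_(i | S i) 1 *: F i) M + \sum_(i | S i) b i.
  rewrite fdot_suml big_distrr -big_split; apply: eq_bigr => i _ /=.
  by rewrite -fdot_F_E -fdot_F_Y scale1r fdotDr fdotNr fdotZr; ring.
(* All coefficients are 1, and at most [n] of them occur, so [w = 1] and [e = sn]. *)
have e2 : `|fdot (\sum_(i | S i) 1 *: F i) M| <= r%:R * (1 * n%:R) + sn * (eps * n%:R).
  apply: sum_F_M_le => //.
    by move=> i _; rewrite ler01 lexx.
  by rewrite snn; under eq_bigr do rewrite expr1n; exact: kept_le_n.
have e3 : p * fdot (\sum_(i | S i) 1 *: F i) M <= r%:R * (1 * n%:R) + sn * (eps * n%:R).
  apply: le_trans e2; apply: le_trans (ler_norm _) _.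
  by rewrite normrM (ger0_norm (ltW p_gt0)) ler_piMl.
have q0 : 0 <= q by apply: sumr_ge0.
have g : q * (eta / 4 * Num.sqrt (n%:R * p)) <= q * (t - t1) by rewrite ler_wpM2l// threshold_gap.
have w1 : omega * n%:R * t1 <= omega * n%:R * (3 * sn).
  by rewrite ler_wpM2l ?t1_le// mulr_ge0.
apply: (le_trans g); have h := sum_b_le; rewrite e1 in H.
rewrite mulrBr; lra.
Qed.

(* Bounds the proportion of singular values of Y above the threshold. *)
Definition kappa delta := 4 / (eta * Num.sqrt delta) * (r%:R / sn + eps + 3 * omega).

Lemma kept_le_kappa delta : 0 < delta -> delta <= p -> q <= n%:R * kappa delta.
Proof.
move=> d0 dp.
have e0 := eta_gt0.
have sd0 : 0 < Num.sqrt delta by rewrite sqrtr_gt0.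
have h : q * (eta / 4 * (sn * Num.sqrt delta)) <= n%:R * (r%:R + eps * sn + 3 * omega * sn).
  apply: le_trans kept_bound; rewrite ler_wpM2l//; first exact: sumr_ge0.
  by rewrite ler_wpM2l ?divr_ge0 ?(ltW e0)// sqrtrM// ler_wpM2l ?sqrtr_ge0// ler_wsqrtr.
have c0 : 0 < eta / 4 * (sn * Num.sqrt delta) by rewrite !mulr_gt0 ?divr_gt0.
rewrite -(ler_pM2r c0) (le_trans h)// le_eqVlt; apply/orP; left; apply/eqP.
by rewrite /kappa; field; rewrite !gt_eqF.
Qed.

Lemma Yh_loss delta : 0 < delta -> delta <= p ->
  fdot (Yh - p *: M) (Yh - p *: M) <=
  n%:R ^+ 2 * (3 * Num.sqrt (kappa delta + omega) + r%:R * gamma + 3 * eps + 3 * r%:R / sn).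
Proof.
move=> d0 dp.
(* Pairing the error with this second form of itself and using [fdot_Yh_Rm] leaves three terms. *)
have E_split : Yh - p *: M = E - Rm by rewrite [in RHS]Y_split [RHS]addrAC addrK.
have -> : fdot (Yh - p *: M) (Yh - p *: M) =
    fdot Yh E - p * fdot M E + p * fdot Rm M.
  rewrite [in X in fdot _ X]E_split fdotDl !fdotDr !fdotNl !fdotNr !fdotZl fdot_Yh_Rm.
  rewrite (fdotC Rm M); ring.
have ko : 0 <= kappa delta + omega.
  rewrite addr_ge0// /kappa mulr_ge0 ?divr_ge0 ?mulr_ge0 ?sqrtr_ge0 ?(ltW eta_gt0)//.
  by rewrite !addr_ge0 ?divr_ge0 ?mulr_ge0 ?sqrtr_ge0.
(* Against [Yh], the noise may be replaced by its components [b i] along the kept [F i], whose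
   squares are summed by [sum_b2_le]. *)
have h1 : `|fdot Yh E| <= n%:R * (3 * n%:R * Num.sqrt (kappa delta + omega)).
  have -> : fdot Yh E = fdot Yh (\sum_(i | S i) b i *: F i).
    rewrite fdot_F_sum fdot_suml; apply: eq_bigr => i _.
    by rewrite fdotZl fdot_F_E.
  apply: fdot_norm_le; rewrite ?fdot_kept_le ?mulr_ge0 ?sqrtr_ge0//.
  rewrite fdot_F_sum; under eq_bigr do rewrite -expr2.
  apply: le_trans sum_b2_le _; rewrite [leRHS]exprMn (sqr_sqrtr ko).
  have a1 : q + omega * n%:R <= n%:R * (kappa delta + omega).
    by have := kept_le_kappa d0 dp; rewrite mulrDr (mulrC omega) lerD2r.
  have a2 : t1 ^+ 2 <= 3 ^+ 2 * n%:R.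
    by rewrite -[in leRHS]snn -[leRHS]exprMn lerXn2r ?t1_le// nnegrE ?(ltW t1_gt0)// mulr_ge0 ?sqrtr_ge0.
  apply: le_trans (ler_pM _ _ a1 a2) _; rewrite ?sqr_ge0//.
    by rewrite addr_ge0 ?mulr_ge0//; apply: sumr_ge0.
  by rewrite le_eqVlt; apply/orP; left; apply/eqP; ring.
have h2 : `|p * fdot M E| <= r%:R * (gamma * n%:R ^+ 2) + eps * n%:R * (2 * n%:R).
  rewrite normrM (ger0_norm (ltW p_gt0)) (@le_trans _ _ `|fdot M E|) ?ler_piMl//.
  rewrite [in X in fdot X _]M_split fdotDl fdot_suml (le_trans (ler_normD _ _))// lerD//.
    apply: le_trans (ler_norm_sum _ _ _) _.
    apply: (@le_trans _ _ (\sum_(a < r) gamma * n%:R ^+ 2)); last by rewrite sumr_const card_ord mulr_natl.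
    by apply: ler_sum => a _; rewrite fdot_outer noise_bilinear.
  by apply: fdot_norm_le; rewrite ?fdot_noise_le ?mulr_ge0.
(* The dropped coefficients are below the threshold, hence at most [3 * sn]. *)
have h3 : `|p * fdot Rm M| <= r%:R * (3 * sn * n%:R) + n%:R * (eps * n%:R).
  rewrite normrM (ger0_norm (ltW p_gt0)) (@le_trans _ _ `|fdot Rm M|) ?ler_piMl//.
  apply: sum_F_M_le; rewrite ?mulr_ge0 ?sqrtr_ge0//.
    move=> i; rewrite -ltNge => /ltW si; rewrite (svd_ge0 svd) (le_trans si)//.
    exact: t_le.
  apply: le_trans fdot_dropped_le; rewrite fdot_F_sum.
  by under [leRHS]eq_bigr do rewrite -expr2.
move: h1 h2 h3; rewrite !ler_norml => /andP[_ h1] /andP[h2 _] /andP[_ h3].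
have e1 : r%:R * (3 * sn * n%:R) = n%:R ^+ 2 * (3 * r%:R / sn).
  have -> : n%:R ^+ 2 = n%:R * sn ^+ 2 by rewrite snn expr2.
  by field; rewrite gt_eqF.
rewrite e1 in h3; lra.
Qed.

End Deterministic.

(** * Approximation of distance matrices by matrices of bounded rank *)

Lemma mdist_le1 (R : realType) (K : metricType R) (a b : K) :
  (diameter [set: K] <= 1)%E -> mdist a b <= 1.
Proof.
move=> dK; rewrite -lee_fin; apply: le_trans dK; apply: ereal_sup_ubound.
by exists (a, b).
Qed.

(** Compactness in near-covering form, for the filter of finite sequences directed by inclusion:
    near [y], every sequence containing [y] serves. *)
Lemma finite_net (R : realType) (K : metricType R) (e : R) :
  compact [set: K] -> 0 < e ->
  exists cs : seq K, forall y, has (fun c => mdist c y < e) cs.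
Proof.
move=> /compact_near_coveringP cK e0.
pose F : set_system (seq K) :=
  filter_from setT (fun s : seq K => [set t : seq K | {subset s <= t}]).
have FF : Filter F.
  apply: filter_from_filter; first by exists [::].
  move=> s t _ _; exists (s ++ t) => // v sub; split => y yv; apply: sub;
    by rewrite mem_cat yv ?orbT.
have [|s _ sub] := cK (seq K) F (fun s y => has (fun c => mdist c y < e) s) FF.
  move=> y _; exists (ball y e, [set t : seq K | y \in t]) => /=.
    split; first exact: nbhsx_ballx.
    by exists [:: y] => // t; apply; exact: mem_head.
  move=> [y' t] [/= yy' yt]; apply/hasP; exists y => //.
  by move: yy'; rewrite ballEmdist.
by exists s => y; exact: (sub s).
Qed.

(** Each point is replaced, in the row index only, by the first net point within [e] of it. Rows
    with the same net point then coincide, so the rank is at most the size of the net, which is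
    independent of [n]; the triangle inequality bounds the entries of the remainder by [e]. *)
Lemma distance_matrix_split (R : realType) (K : metricType R) (e : R) :
  compact [set: K] -> (diameter [set: K] <= 1)%E -> 0 < e ->
  exists r : nat, forall n (x : 'I_n -> K), exists (a z : 'I_r -> 'cV[R]_n) (D : 'M[R]_n),
    [/\ distance_matrix x = \sum_k a k *m (z k)^T + D,
        forall k, fdot (a k) (a k) <= n%:R,
        forall k, fdot (z k) (z k) <= n%:R &
        fdot D D <= (e * n%:R) ^+ 2].
Proof.
move=> cK dK e0; have [cs csP] := finite_net cK e0.
exists (size cs) => n x.
pose near i := fun c => mdist c (x i) < e.
pose a (k : 'I_(size cs)) : 'cV[R]_n := \col_i (find (near i) cs == k)%:R.
(* The default [x j] of [nth] is never returned, as [k] is below [size cs]; it spares the choice of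
   an element of [K], which might be empty. *)
pose z (k : 'I_(size cs)) : 'cV[R]_n := \col_j mdist (nth (x j) cs k) (x j).
have cv (y : 'cV[R]_n) : (forall i, `|y i 0| <= 1) -> fdot y y <= n%:R.
  move=> y1; have := @entries_le R n 1 y 1; rewrite expr1n !mulr1; apply.
  by move=> i j; rewrite ord1.
exists a, z, (distance_matrix x - \sum_k a k *m (z k)^T); split.
- by rewrite addrC subrK.
- by move=> k; apply: cv => i; rewrite mxE; case: (_ == _); rewrite ?normr1 ?normr0.
- by move=> k; apply: cv => i; rewrite mxE ger0_norm ?mdist_ge0// mdist_le1.
rewrite exprMn mulrC (_ : n%:R ^+ 2 = n%:R * n%:R); last by rewrite expr2.
apply: entries_le => i j.
have fi : (find (near i) cs < size cs)%N by rewrite -has_find; exact: csP.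
rewrite !mxE summxE (bigD1 (Ordinal fi))//= big1 => [|k ki]; last first.
  rewrite mxE big_ord1 !mxE (_ : (_ == _) = false) ?mul0r//.
  by apply: contraNF ki => /eqP h; apply/eqP/val_inj.
rewrite mxE big_ord1 !mxE eqxx mul1r addr0.
have nx : mdist (nth (x j) cs (find (near i) cs)) (x i) < e.
  exact: (nth_find (x j) (csP (x i))).
set c := nth _ _ _ in nx *.
rewrite ler_norml; apply/andP; split.
  by have := metric_triangle c (x i) (x j); lra.
by have := metric_triangle (x i) c (x j); rewrite (metric_sym (x i) c); lra.
Qed.

(** * From the thresholded matrix to the estimate *)

Section UsvtLoss.
Context (R : realType) (n : nat).

Lemma truncate_contract (w m : R) : `|m| <= 1 ->
  (truncate w - m) ^+ 2 <= (w - m) ^+ 2.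
Proof. by rewrite ler_norml /truncate => /andP[? ?]; do !case: ifP => [?|]; nra. Qed.

(** Truncation moves no entry away from [M]. Scaling by [ph] splits the error into that of [Yh]
    against [p *: M] and the error [p - ph] of the proportion; the 2 comes from squaring this
    sum. *)
Lemma usvt_loss (eta ph p : R) (M U V : 'M[R]_n) (s : 'I_n -> R) :
  0 < ph -> (forall i j, `|M i j| <= 1) ->
  let Yh := \sum_(i < n | (2 + eta) * Num.sqrt (n%:R * ph) <= s i)
         s i *: (col i U *m (col i V)^T) in
  \sum_i \sum_j (map_mx (@truncate R) (usvt_W eta ph U s V) i j - M i j) ^+ 2 <=
  2 / ph ^+ 2 * (fdot (Yh - p *: M) (Yh - p *: M) + (p - ph) ^+ 2 * n%:R ^+ 2).
Proof.
move=> ph0 M1 /=; set Yh := \sum_(i < n | _) _ *: _; set W := usvt_W eta ph U s V.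
have WE : ph *: (W - M) = (Yh - p *: M) + (p - ph) *: M.
  rewrite /W /usvt_W gt_eqF// scalerBr scalerA mulfV ?gt_eqF// scale1r scalerBl.
  by rewrite addrA subrK.
apply: (@le_trans _ _ (fdot (W - M) (W - M))).
  apply: ler_sum => i _; apply: ler_sum => j _.
  by rewrite mxE !mxE -expr2 truncate_contract.
have MM : fdot M M <= n%:R ^+ 2.
  by apply: le_trans (entries_le M1) _; rewrite expr1n mulr1 expr2.
rewrite mulrAC ler_pdivlMr ?exprn_gt0// mulrC.
have -> : ph ^+ 2 * fdot (W - M) (W - M) = fdot (ph *: (W - M)) (ph *: (W - M)).
  by rewrite fdotZl fdotZr expr2 mulrA.
rewrite WE; set A := Yh - _; set B := (p - ph) *: M.
have BB : fdot B B <= (p - ph) ^+ 2 * n%:R ^+ 2.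
  by rewrite fdotZl fdotZr mulrA -expr2 ler_wpM2l ?sqr_ge0.
have le2 (A' B' : 'M[R]_n) : fdot (A' + B') (A' + B') <= 2 * (fdot A' A' + fdot B' B').
  have := fdot_ge0 (A' - B').
  by rewrite !fdotDl !fdotDr !fdotNl !fdotNr (fdotC B' A'); lra.
by apply: le_trans (le2 A B) _; rewrite ler_wpM2l// lerD2l.
Qed.

End UsvtLoss.

(** * Symmetric matrices carrying the noise in the two models *)

Lemma fdot_col_mx (R : realType) n1 n2 m (A1 B1 : 'M[R]_(n1, m)) (A2 B2 : 'M[R]_(n2, m)) :
  fdot (col_mx A1 A2) (col_mx B1 B2) = fdot A1 B1 + fdot A2 B2.
Proof.
rewrite /fdot big_split_ord; congr (_ + _); apply: eq_bigr => i _; apply: eq_bigr => j _.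
  by rewrite !col_mxEu.
by rewrite !col_mxEd.
Qed.

Definition keyed_mx (R : realType) n N (key : 'I_N -> 'I_N -> option ('I_n * 'I_n))
    (e : 'I_n * 'I_n -> R) : 'M[R]_N := \matrix_(a, b) oapp e 0 (key a b).

(** Names an unordered pair by its entry on or above the diagonal, the one that is drawn
    independently. *)
Definition sym_key n (i j : 'I_n) : option ('I_n * 'I_n) :=
  Some (if (i <= j)%N then (i, j) else (j, i)).

(* Key of the Hermitian dilation [0, E; E^T, 0] of an asymmetric matrix E. *)
Definition bip_key n (a b : 'I_(n + n)) : option ('I_n * 'I_n) :=
  match fintype.split a, fintype.split b with
  | inl i, inr j => Some (i, j)
  | inr j, inl i => Some (i, j)
  | _, _ => None
  end.

Lemma bip_keyed_mx (R : realType) n (e : 'I_n * 'I_n -> R) :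
  keyed_mx (@bip_key n) e =
  block_mx 0 (\matrix_(i, j) e (i, j)) (\matrix_(i, j) e (i, j))^T 0.
Proof.
apply/matrixP => a b; rewrite [LHS]mxE /bip_key.
rewrite -[in RHS](splitK a) -[in RHS](splitK b).
by case: (fintype.split a) => i; case: (fintype.split b) => j /=;
  rewrite ?block_mxEul ?block_mxEur ?block_mxEdl ?block_mxEdr !mxE.
Qed.

(** What the moment method asks of a symmetric matrix made of noise entries, together with
    isometries [l] and [r] that recover the bilinear form of the noise from it. It lets both data
    models share one argument. *)
Record walk_model (R : realType) n (mo : data_model) N
    (key : 'I_N -> 'I_N -> option ('I_n * 'I_n)) (l r : 'cV[R]_n -> 'cV[R]_N) : Prop := {
  wm_size : (n <= N <= 2 * n)%N ;
  wm_sym : forall a b, key a b = key b a ;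
  wm_inj : forall a b a' b', key a b != None -> key a b = key a' b' ->
    a' = a /\ b' = b \/ a' = b /\ b' = a ;
  wm_degree : forall a, (#|[pred b | key a b != None]| <= n)%N ;
  wm_free : forall a b e, key a b = Some e -> e \in free_entries mo n ;
  wm_l : forall x y, fdot (l x) (l y) = fdot x y ;
  wm_r : forall x y, fdot (r x) (r y) = fdot x y ;
  wm_bilinear : forall (e : 'I_n * 'I_n -> R),
    (mo = Symmetric -> forall i j, e (i, j) = e (j, i)) -> forall x y,
    fdot (l x) (keyed_mx key e *m r y) = fdot x ((\matrix_(i, j) e (i, j)) *m y)
}.

Lemma sym_walk_model (R : realType) n :
  walk_model Symmetric (@sym_key n) (@id 'cV[R]_n) id.
Proof.
split => //.
- by rewrite leqnn /=; lia.
- move=> a b; rewrite /sym_key; case: (ltngtP a b) => // ab.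
  by have -> : a = b by apply/val_inj.
- move=> a b a' b' _ [].
  by case: ifP => _; case: ifP => _ [-> ->]; [left|right|right|left].
- by move=> a; rewrite (leq_trans (max_card _))// card_ord.
- move=> a b e [<-]; rewrite inE; case: (leqP a b) => //= ab; exact: ltnW.
- move=> e /(_ erefl) es x y; congr (fdot _ (_ *m _)).
  by apply/matrixP => a b; rewrite !mxE /=; case: ifP.
Qed.

Lemma bip_walk_model (R : realType) n :
  walk_model Asymmetric (@bip_key n) (fun x : 'cV[R]_n => col_mx x 0) (fun y => col_mx 0 y).
Proof.
split.
- by rewrite leq_addr /=; lia.
- by move=> a b; rewrite /bip_key; case: (fintype.split a); case: (fintype.split b).
- move=> a b a' b'; rewrite /bip_key.
  rewrite -[in X in _ -> _ -> X](splitK a) -[in X in _ -> _ -> X](splitK b).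
  rewrite -[in X in _ -> _ -> X](splitK a') -[in X in _ -> _ -> X](splitK b').
  by case: (fintype.split a) => i; case: (fintype.split b) => j //=;
    case: (fintype.split a') => i'; case: (fintype.split b') => j' //= _ [-> ->];
    auto.
- move=> a; rewrite /bip_key; case: (fintype.split a) => i.
    rewrite (leq_trans (_ : _ <= #|[set rshift n j | j : 'I_n]|)%N)//.
      apply: subset_leq_card; apply/fintype.subsetP => b; rewrite inE.
      rewrite -{2}[b]splitK; case: (fintype.split b) => // j _.
      by apply/imsetP; exists j.
    by rewrite (leq_trans (leq_imset_card _ _))// card_ord.
  rewrite (leq_trans (_ : _ <= #|[set lshift n j | j : 'I_n]|)%N)//.
    apply: subset_leq_card; apply/fintype.subsetP => b; rewrite inE.
    rewrite -{2}[b]splitK; case: (fintype.split b) => // j _.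
    by apply/imsetP; exists j.
  by rewrite (leq_trans (leq_imset_card _ _))// card_ord.
- by move=> a b e _; rewrite inE.
- by move=> x y; rewrite fdot_col_mx fdot0l addr0.
- by move=> x y; rewrite fdot_col_mx fdot0l add0r.
- move=> e _ x y; rewrite bip_keyed_mx mul_block_col !mul0mx mulmx0 add0r addr0.
  by rewrite fdot_col_mx fdot0l addr0.
Qed.

(** * The mean squared error *)

(** The loss is not known to be measurable, since the estimate comes from an arbitrary choice of
    decompositions. The integral of a nonnegative function is a supremum over simple functions below
    it, which gives monotonicity directly. *)
Lemma expectation_le_mean (d : measure_display) (T : measurableType d) (R : realType)
    (P : probability T R) (f g : T -> R) :
  (forall w, 0 <= f w) -> (forall w, f w <= g w) -> bounded_measurable g ->
  ('E_P[f] <= (mean_value P g)%:E)%E.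
Proof.
move=> f0 fg bg; rewrite /mean_value /Rintegral fineK; last first.
  by apply: integrable_fin_num => //; exact: bm_integrable.
have g0 w : 0 <= g w := le_trans (f0 w) (fg w).
rewrite unlock !ge0_integralTE => [|w|w]; rewrite ?lee_fin//.
apply: le_ereal_sup => _ [h hf <-]; exists h => // w.
by rewrite (le_trans (hf w))// lee_fin.
Qed.

Section Outcome.
Context (d : measure_display) (T : measurableType d) (R : realType).
Context (P : probability T R) (n : nat) (mo : data_model) (p : R) (M : 'M[R]_n).
Context (X : 'I_n * 'I_n -> {RV P >-> R}) (O : 'I_n * 'I_n -> {RV P >-> bool}).
Hypothesis dm : data_matrix mo p M X O.
Hypothesis M_le1 : forall i j, `|M i j| <= 1.
Hypothesis M_sym : forall i j, M i j = M j i.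
Context (N : nat) (key : 'I_N -> 'I_N -> option ('I_n * 'I_n)).
Context (l r : 'cV[R]_n -> 'cV[R]_N) (wm : walk_model mo key l r).
Context (eta : R) (eta_gt0 : 0 < eta) (eta_lt1 : eta < 1) (n_gt0 : (0 < n)%N).
Context (delta : R) (delta_gt0 : 0 < delta) (p_ge : delta <= p) (p_le1 : p <= 1).

Local Notation ph w := (observed_proportion mo O w).
Local Notation t1 := ((2 + eta / 4) * Num.sqrt (n%:R * p)).
Local Notation Z w j := (\tr (noise_mx p M X O key w ^+ (2 ^ j).*2)).

Let p_gt0 : 0 < p. Proof. exact: lt_le_trans p_ge. Qed.

Lemma in_range_all w : (forall e, e \in free_entries mo n -> `|X e w| <= 1) ->
  forall e, `|X e w| <= 1.
Proof.
move=> X1 [i j]; have [|] := boolP ((i, j) \in free_entries mo n); first exact: X1.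
rewrite inE; case: mo dm X1 => //= dm' X1; rewrite -ltnNge => ji.
have [-> _] := data_symmetric dm' erefl i j w.
by apply: X1; rewrite inE /= ltnW.
Qed.

Lemma noise_sym w : mo = Symmetric ->
  forall i j, noise p M X O (i, j) w = noise p M X O (j, i) w.
Proof.
move=> mS i j; rewrite /noise /= M_sym.
by have [-> ->] := data_symmetric dm mS i j w.
Qed.

Lemma observed_noise w : (forall e, `|X e w| <= 1) ->
  observed_matrix X O w - p *: M = \matrix_(i, j) noise p M X O (i, j) w.
Proof.
move=> X1; apply/matrixP => i j; rewrite !mxE /noise /=.
by case: (O (i, j) w) => //; rewrite truncate_id.
Qed.

Lemma noise_mx_sym w : (noise_mx p M X O key w)^T = noise_mx p M X O key w.
Proof. by apply/matrixP => a b; rewrite !mxE (wm_sym wm). Qed.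

Lemma noise_trace_ge0 w j : 0 <= Z w j.
Proof.
rewrite -addnn exprD -[X in \tr X]/(_ ^+ (2 ^ j) *m _ ^+ (2 ^ j)).
by rewrite trace_gram ?fdot_ge0// sym_exp// noise_mx_sym.
Qed.

Lemma proportion_le1 w : ph w <= 1.
Proof.
rewrite /observed_proportion; have [->|f0] := posnP #|free_entries mo n|.
  by rewrite invr0 mulr0.
rewrite ler_pdivrMr ?ltr0n// mul1r ler_nat; apply: subset_leq_card.
by apply/fintype.subsetP => e; rewrite inE => /andP[].
Qed.

(** Transfers [Yh_loss] to one outcome. The trace bound yields its hypothesis on sums of powers
    through [sum_bilinear_pow_le], and, with the inequality between [omega] and [gamma], its
    hypothesis on bilinear forms through [bilinear_trace_le]. *)
Lemma good_outcome_loss (rk : nat) (a z : 'I_rk -> 'cV[R]_n) (D : 'M[R]_n)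
    (eps omega gamma tau : R) (j : nat) (w : T) (Mh : 'M[R]_n) :
  0 <= eps -> 0 <= omega -> 0 <= gamma -> 0 <= tau ->
  M = \sum_k a k *m (z k)^T + D ->
  (forall k, fdot (a k) (a k) <= n%:R) -> (forall k, fdot (z k) (z k) <= n%:R) ->
  fdot D D <= (eps * n%:R) ^+ 2 ->
  omega * n%:R * t1 ^+ (2 ^ j).*2 <= (gamma * n%:R) ^+ (2 ^ j).*2 ->
  (forall e, e \in free_entries mo n -> `|X e w| <= 1) ->
  Z w j <= omega * n%:R * t1 ^+ (2 ^ j).*2 ->
  tau <= delta * (eta / 6) -> `|ph w - p| <= tau ->
  is_usvt eta (observed_matrix X O w) (ph w) Mh ->
  (n%:R ^+ 2)^-1 * (\sum_i \sum_j (Mh i j - M i j) ^+ 2) <=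
  3 / delta ^+ 2 * (3 * Num.sqrt (kappa n eta rk eps omega delta + omega) +
    rk%:R * gamma + 3 * eps + 3 * rk%:R / Num.sqrt n%:R + tau ^+ 2).
Proof.
move=> eps0 om0 ga0 tau0 MD a1 z1 D1 Hg X1 HZ Ht Hph [U [V' [V [svd ->]]]].
have {}X1 := in_range_all X1.
have E_eq := observed_noise X1.
have bil y y' : fdot y ((observed_matrix X O w - p *: M) *m y') =
    fdot (l y) (noise_mx p M X O key w *m r y').
  rewrite E_eq; symmetry.
  exact: (wm_bilinear wm (e := fun e => noise p M X O e w) (noise_sym w)).
have e2 : (2 ^ j).*2 = (2 ^ j).-1.*2.+2 by rewrite -doubleS prednK// expn_gt0.
have n0 : (0 : R) < n%:R by rewrite ltr0n.
have ph_close : p * (1 - eta / 6) <= ph w.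
  move: Hph; rewrite ler_norml => /andP[h _].
  have : delta * (eta / 6) <= p * (eta / 6) by rewrite ler_wpM2r// divr_ge0// ltW.
  by lra.
have phd : delta * (5 / 6) <= ph w.
  apply: le_trans ph_close; have e1 := eta_lt1; apply: ler_pM; [exact: ltW|lra|exact: p_ge|lra].
have ph0 : 0 < ph w by apply: lt_le_trans phd; rewrite mulr_gt0// divr_gt0.
have n2 : (0 : R) < n%:R ^+ 2 by rewrite exprn_gt0.
rewrite ler_pdivrMl//.
apply: le_trans (usvt_loss eta p U V V' ph0 M_le1) _.
set rho := (X in _ * (X + tau ^+ 2)).
have Yl : fdot (\sum_(i < n | (2 + eta) * Num.sqrt (n%:R * ph w) <= V' i)
         V' i *: (col i U *m (col i V)^T) - p *: M) (\sum_(i < n | (2 + eta) * Num.sqrt (n%:R * ph w) <= V' i)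
         V' i *: (col i U *m (col i V)^T) - p *: M) <= n%:R ^+ 2 * rho.
  apply: (Yh_loss eta_gt0 eta_lt1 n_gt0 p_gt0 p_le1 (proportion_le1 w) ph_close svd _ M_le1
    (k := (2 ^ j).-1) eps0 MD a1 z1 D1 om0) => //.
  - move=> i i'; rewrite mxE; case: ifP => _; [exact: X1|by rewrite normr0].
  - move=> S; rewrite -e2; under eq_bigr do rewrite bil.
    apply: le_trans HZ; apply: sum_bilinear_pow_le (noise_mx_sym w) _ _ => i.
      by rewrite (wm_l wm) (col_orthonormal _ _ (svd_left svd)) eqxx.
    by move=> i'; rewrite (wm_r wm) (col_orthonormal _ _ (svd_right svd)).
  - move=> y y' y1 y1'; rewrite bil.
    rewrite -(ler_pXn2r (n := (2 ^ j).*2)) ?double_gt0 ?expn_gt0 ?nnegrE ?mulr_ge0//.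
    rewrite -[X in `|_| ^+ X]mul2n exprM real_normK ?num_real// -exprM mul2n.
    apply: le_trans (bilinear_trace_le _ _ _ (noise_mx_sym w)) _.
    rewrite (wm_l wm) (wm_r wm).
    have -> : (gamma * n%:R ^+ 2) ^+ (2 ^ j).*2 = (n%:R * n%:R) ^+ (2 ^ j) * (gamma * n%:R) ^+ (2 ^ j).*2.
      rewrite expr2 mulrA [X in X ^+ _ = _]mulrC exprMn; congr (_ * _).
      by rewrite -expr2 -exprM mul2n.
    apply: ler_pM; rewrite ?exprn_ge0 ?mulr_ge0 ?fdot_ge0 ?noise_trace_ge0//; last exact: le_trans HZ Hg.
    by rewrite lerXn2r ?nnegrE ?mulr_ge0 ?fdot_ge0// ler_pM ?fdot_ge0.
(* As [ph w] is at least 5/6 of [delta], the factor is at most 2 * 36/25 = 2.88 over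
   [delta ^+ 2]. *)
have c1 : 2 / ph w ^+ 2 <= 3 / delta ^+ 2.
  rewrite ler_pdivrMr ?exprn_gt0// mulrAC ler_pdivlMr ?exprn_gt0//.
  have : (delta * (5 / 6)) ^+ 2 <= ph w ^+ 2 by rewrite lerXn2r ?nnegrE ?(ltW ph0)// mulr_ge0 ?divr_ge0// ltW.
  by rewrite exprMn; have := sqr_ge0 delta; lra.
have t2 : (p - ph w) ^+ 2 <= tau ^+ 2.
  by rewrite -sqrrN opprB -real_normK ?num_real// lerXn2r ?nnegrE.
have rho0 : 0 <= n%:R ^+ 2 * rho by apply: le_trans Yl; exact: fdot_ge0.
apply: (@le_trans _ _ (3 / delta ^+ 2 * (n%:R ^+ 2 * rho + tau ^+ 2 * n%:R ^+ 2))).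
  apply: ler_pM => //; first by rewrite divr_ge0// sqr_ge0.
    by rewrite addr_ge0 ?fdot_ge0// mulr_ge0 ?sqr_ge0.
  by apply: lerD => //; rewrite ler_pM2r.
by rewrite le_eqVlt; apply/orP; left; apply/eqP; ring.
Qed.

End Outcome.

Section Mse.
Context (d : measure_display) (T : measurableType d) (R : realType).
Context (P : probability T R) (n : nat) (mo : data_model) (p : R) (M : 'M[R]_n).
Context (X : 'I_n * 'I_n -> {RV P >-> R}) (O : 'I_n * 'I_n -> {RV P >-> bool}).
Hypothesis dm : data_matrix mo p M X O.
Hypothesis M_le1 : forall i j, `|M i j| <= 1.
Hypothesis M_sym : forall i j, M i j = M j i.
Context (N : nat) (key : 'I_N -> 'I_N -> option ('I_n * 'I_n)).
Context (l r : 'cV[R]_n -> 'cV[R]_N) (wm : walk_model mo key l r).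
Context (eta : R) (eta_gt0 : 0 < eta) (eta_lt1 : eta < 1) (n_gt0 : (0 < n)%N).
Context (delta : R) (delta_gt0 : 0 < delta) (p_ge : delta <= p) (p_le1 : p <= 1).
Context (Mhat : T -> 'M[R]_n).
Hypothesis usvt : forall w,
  is_usvt eta (observed_matrix X O w) (observed_proportion mo O w) (Mhat w).

Local Notation free := (free_entries mo n).
Local Notation ph w := (observed_proportion mo O w).
Local Notation t1 := ((2 + eta / 4) * Num.sqrt (n%:R * p)).
Local Notation Z w j := (\tr (noise_mx p M X O key w ^+ (2 ^ j).*2)).

Let p_gt0 : 0 < p. Proof. exact: lt_le_trans p_ge. Qed.
Let nR_gt0 : (0 : R) < n%:R. Proof. by rewrite ltr0n. Qed.

Lemma card_free : (n <= #|free|)%N.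
Proof.
have inj : injective (fun i : 'I_n => (i, i)) by move=> i i' [].
rewrite -[leqLHS](card_ord n) -(card_codom inj).
apply: subset_leq_card; apply/fintype.subsetP => e /codomP[i ->].
by rewrite inE; case: (mo) => /=.
Qed.

Lemma bm_proportion : bounded_measurable (fun w => ph w).
Proof.
rewrite (_ : (fun w => _) =
  (fun w => #|free|%:R^-1 * \sum_(e in free) if O e w then 1 else 0)).
  apply: bm_mul; first exact: bm_cst.
  by apply: bm_sum => e; apply: bm_if_observed; exact: bm_cst.
apply/funext => w; rewrite /observed_proportion mulrC; congr (_ * _).
rewrite -sum1dep_card big_mkcondr natr_sum; apply: eq_bigr => e _.
by case: (O e w).
Qed.

Lemma loss_le4 w : (n%:R ^+ 2)^-1 * (\sum_i \sum_j (Mhat w i j - M i j) ^+ 2) <= 4.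
Proof.
have [U [s [V [_ ->]]]] := usvt w.
rewrite ler_pdivrMl ?exprn_gt0//.
apply: (@le_trans _ _ (\sum_(i < n) \sum_(j < n) 4)).
  apply: ler_sum => i _; apply: ler_sum => j _; rewrite mxE.
  have := truncate_norm (usvt_W eta (ph w) U s V i j); have := M_le1 i j.
  by rewrite !ler_norml => /andP[? ?] /andP[? ?]; nra.
by rewrite !sumr_const !card_ord -mulrnA -[leLHS]mulr_natl natrM expr2.
Qed.

Lemma sqrt_pow_double (c x : R) m : 0 <= x ->
  (c * Num.sqrt x) ^+ m.*2 = (c ^+ 2 * x) ^+ m.
Proof. by move=> x0; rewrite -mul2n exprM; congr (_ ^+ _); rewrite exprMn sqr_sqrtr. Qed.

(** The first term comes from the walks with few vertices and vanishes as [n] grows; its 8 is 4 from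
    the bound 2 per step, times 2 from [N <= 2 * n]. The second is small for large [j] because
    [(2 + eta / 4) ^+ 2] exceeds 4. *)
Lemma trace_ratio (omega : R) (j : nat) : 0 < omega ->
  mean_value P (fun w => Z w j) / (omega * n%:R * t1 ^+ (2 ^ j).*2) <=
  (8 ^+ (2 ^ j) * (2 ^ j).+1%:R ^+ (2 ^ j).*2) / (omega * delta ^+ (2 ^ j)) / n%:R +
    2 / omega * (4 / (2 + eta / 4) ^+ 2) ^+ (2 ^ j).
Proof.
move=> om0; set m := (2 ^ j)%N.
have m0 : (0 < m)%N by rewrite expn_gt0.
have /andP[nN N2n] := wm_size wm.
have N0 : (0 < N)%N := leq_trans n_gt0 nN.
have B0 : 0 < 2 + eta / 4 by have e0 := eta_gt0; lra.
have A1 : 1 <= (2 + eta / 4) ^+ 2.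
  by have e0 := eta_gt0; rewrite expr_ge1//; lra.
have A0 : 0 < (2 + eta / 4) ^+ 2 := lt_le_trans ltr01 A1.
rewrite sqrt_pow_double ?mulr_ge0// ?(ltW p_gt0)//.
set A := (2 + eta / 4) ^+ 2 in A1 A0 *.
have z0 : 0 < omega * n%:R * (A * (n%:R * p)) ^+ m.
  by apply: mulr_gt0; [exact: mulr_gt0|apply: exprn_gt0; apply: mulr_gt0 => //; exact: mulr_gt0].
rewrite ler_pdivrMr//.
apply: le_trans (trace_moment dm (ltW p_gt0) p_le1 M_le1 (wm_sym wm) (wm_inj wm)
  (wm_degree wm) (wm_free wm) m0 n_gt0 N0) _.
rewrite [leRHS]mulrDl; apply: lerD.
  have h1 : 2 ^+ m.*2 * (N ^ m * m.+1 ^ m.*2)%:R <=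
      8 ^+ m * m.+1%:R ^+ m.*2 * n%:R ^+ m :> R.
    rewrite natrM !natrX mulrA [leRHS]mulrAC ler_wpM2r ?exprn_ge0//.
    apply: (@le_trans _ _ (2 ^+ m.*2 * (2 * n%:R) ^+ m)).
      rewrite ler_wpM2l ?exprn_ge0// lerXn2r ?nnegrE//.
      by rewrite -natrM ler_nat.
    by rewrite exprMn mulrA -mul2n exprM -exprMn (_ : 2 ^+ 2 * 2 = 8)//; ring.
  apply: le_trans h1 _.
  set C := 8 ^+ m * _.
  have C0 : 0 <= C by rewrite mulr_ge0 ?exprn_ge0.
  have -> : C / (omega * delta ^+ m) / n%:R * (omega * n%:R * (A * (n%:R * p)) ^+ m) =
     C * ((A * (n%:R * p)) ^+ m / delta ^+ m).
    by field; rewrite !gt_eqF ?exprn_gt0.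
  rewrite ler_wpM2l// ler_pdivlMr ?exprn_gt0// -exprMn lerXn2r ?nnegrE//.
  - exact: mulr_ge0 (ltW nR_gt0) (ltW delta_gt0).
  - exact: mulr_ge0 (ltW A0) (mulr_ge0 (ltW nR_gt0) (ltW p_gt0)).
  - by rewrite mulrCA ler_wpM2l// (le_trans p_ge)// ler_peMl// (ltW p_gt0).
have -> : 2 / omega * (4 / A) ^+ m * (omega * n%:R * (A * (n%:R * p)) ^+ m) =
    2 * n%:R * (4 * (n%:R * p)) ^+ m.
  rewrite !expr_div_n !exprMn; field.
  by rewrite !gt_eqF ?exprn_gt0.
have -> : p ^+ m * (N * (4 * n) ^ m)%:R = N%:R * (4 * (n%:R * p)) ^+ m.
  by rewrite natrM natrX natrM !exprMn; ring.
rewrite ler_wpM2r ?exprn_ge0 ?mulr_ge0 ?(ltW p_gt0)//.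
by rewrite -natrM ler_nat.
Qed.

Lemma mse_le (rk : nat) (a z : 'I_rk -> 'cV[R]_n) (D : 'M[R]_n)
    (eps omega gamma tau : R) (j : nat) :
  0 <= eps -> 0 < omega -> 0 <= gamma -> 0 < tau ->
  M = \sum_k a k *m (z k)^T + D ->
  (forall k, fdot (a k) (a k) <= n%:R) -> (forall k, fdot (z k) (z k) <= n%:R) ->
  fdot D D <= (eps * n%:R) ^+ 2 ->
  omega * n%:R * t1 ^+ (2 ^ j).*2 <= (gamma * n%:R) ^+ (2 ^ j).*2 ->
  tau <= delta * (eta / 6) ->
  (MSE P Mhat M <= (3 / delta ^+ 2 *
    (3 * Num.sqrt (kappa n eta rk eps omega delta + omega) +
     rk%:R * gamma + 3 * eps + 3 * rk%:R / Num.sqrt n%:R + tau ^+ 2) +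
    4 * ((8 ^+ (2 ^ j) * (2 ^ j).+1%:R ^+ (2 ^ j).*2) / (omega * delta ^+ (2 ^ j)) / n%:R +
    2 / omega * (4 / (2 + eta / 4) ^+ 2) ^+ (2 ^ j) + 1 / (tau ^+ 2 * n%:R)))%:E)%E.
Proof.
move=> eps0 om0 ga0 tau0 MD a1 z1 D1 Hg Ht.
set L := 3 / delta ^+ 2 * _.
have L0 : 0 <= L.
  have k0 : 0 <= rk%:R * gamma + 3 * eps + 3 * rk%:R / Num.sqrt n%:R + tau ^+ 2.
    by rewrite !addr_ge0 ?sqr_ge0// ?divr_ge0 ?mulr_ge0 ?sqrtr_ge0.
  by rewrite /L mulr_ge0 ?divr_ge0 ?sqr_ge0// -!addrA addr_ge0 ?mulr_ge0 ?sqrtr_ge0// !addrA.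
set z0 := omega * n%:R * t1 ^+ (2 ^ j).*2 in Hg *.
have z0_gt0 : 0 < z0.
  have e0 := eta_gt0.
  by rewrite !mulr_gt0// exprn_gt0// mulr_gt0 ?sqrtr_gt0 ?mulr_gt0//; lra.
pose out w : R := \sum_(e in free) \1_[set w | 1 < `|X e w|] w.
have bout : bounded_measurable out by apply: bm_sum => e; apply: bm_indic; exact: measurable_out_of_range.
have bZ := bm_trace_noise_mx p M X O key (2 ^ j).*2.
have bq : bounded_measurable (fun w => (ph w - p) ^+ 2).
  by apply: bm_exp; apply: bm_add; [exact: bm_proportion|exact: bm_cst].
(* On each exceptional event (an entry out of range, a large trace, a proportion far from [p]) one
   of the three nonnegative summands is at least 1, while the loss is at most 4. The Markov and
   Chebyshev inequalities are thus contained in the mean of [g]. *)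
pose g w := L + 4 * (out w + (z0^-1 * Z w j + (tau ^+ 2)^-1 * (ph w - p) ^+ 2)).
have bZ0 : bounded_measurable (fun w => z0^-1 * Z w j) by apply: bm_mul; [exact: bm_cst|].
have bq0 : bounded_measurable (fun w => (tau ^+ 2)^-1 * (ph w - p) ^+ 2).
  by apply: bm_mul; [exact: bm_cst|].
have bs1 : bounded_measurable (fun w => z0^-1 * Z w j + (tau ^+ 2)^-1 * (ph w - p) ^+ 2) by exact: bm_add.
have bs : bounded_measurable (fun w => out w + (z0^-1 * Z w j + (tau ^+ 2)^-1 * (ph w - p) ^+ 2)) by exact: bm_add.
have b4 : bounded_measurable (fun w => 4 * (out w + (z0^-1 * Z w j + (tau ^+ 2)^-1 * (ph w - p) ^+ 2))).
  by apply: bm_mul => //; exact: bm_cst.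
have bg : bounded_measurable g by apply: bm_add => //; exact: bm_cst.
have out0 w : 0 <= out w by apply: sumr_ge0 => e _; rewrite indicE.
have zw0 w : 0 <= z0^-1 * Z w j.
  by rewrite mulr_ge0 ?invr_ge0 ?(ltW z0_gt0)// (noise_trace_ge0 p M X O wm).
have q0 w : 0 <= (tau ^+ 2)^-1 * (ph w - p) ^+ 2 by rewrite mulr_ge0 ?invr_ge0 ?sqr_ge0.
rewrite /MSE; apply: (@le_trans _ _ (mean_value P g)%:E); first (apply: expectation_le_mean (bg) => w).
- by rewrite mulr_ge0 ?invr_ge0 ?sqr_ge0//; do 2! apply: sumr_ge0 => ? _; rewrite sqr_ge0.
- have bad : 1 <= out w + (z0^-1 * Z w j + (tau ^+ 2)^-1 * (ph w - p) ^+ 2) ->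
      (n%:R ^+ 2)^-1 * (\sum_i \sum_j (Mhat w i j - M i j) ^+ 2) <= g w.
    by move=> h; apply: (le_trans (loss_le4 w)); rewrite /g; lra.
  have [[e ef Xe]|X1] := pselect (exists2 e, e \in free & 1 < `|X e w|).
    apply: bad; rewrite /out (bigD1 e)//= indicE mem_set//=.
    rewrite -addrA lerDl addr_ge0 ?addr_ge0//.
    by apply: sumr_ge0 => i _; rewrite indicE.
  have [Zw|Zw] := leP (Z w j) z0; last first.
    apply: bad; have : 1 <= z0^-1 * Z w j by rewrite ler_pdivlMl// mulr1 ltW.
    by have := out0 w; have := q0 w; lra.
  have [qw|qw] := leP `|ph w - p| tau; last first.
    apply: bad; have : 1 <= (tau ^+ 2)^-1 * (ph w - p) ^+ 2.
      rewrite ler_pdivlMl ?exprn_gt0// mulr1 -[leRHS]real_normK ?num_real//.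
      by rewrite lerXn2r ?nnegrE ?(ltW tau0) ?(ltW qw).
    by have := out0 w; have := zw0 w; lra.
  have X1' e : e \in free -> `|X e w| <= 1.
    by move=> ef; rewrite leNgt; apply/negP => h; apply: X1; exists e.
  have := good_outcome_loss dm M_le1 M_sym wm eta_gt0 eta_lt1 n_gt0 delta_gt0 p_ge
    p_le1 eps0 (ltW om0) ga0 (ltW tau0) MD a1 z1 D1 Hg X1' Zw Ht qw (usvt w).
  move=> /le_trans; apply.
  by rewrite /g -/L lerDl mulr_ge0// !addr_ge0.
rewrite lee_fin /g mean_add//; last exact: bm_cst.
rewrite mean_cst lerD2l mean_scale// ler_pM2l//.
rewrite mean_add// mean_add// !mean_scale// mean_sum => [|e]; last by apply: bm_indic; exact: measurable_out_of_range.
rewrite big1 ?add0r => [|e ef]; last exact: (prob_out_of_range dm).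
apply: lerD.
  by rewrite mulrC; exact: trace_ratio.
rewrite div1r [leRHS]invfM ler_wpM2l ?invr_ge0 ?sqr_ge0//.
have f0 : (0 < #|free|)%N := leq_trans n_gt0 card_free.
apply: le_trans (mean_proportion_sq dm (ltW p_gt0) p_le1 f0) _.
by rewrite lef_pV2 ?posrE ?ltr0n// ler_nat card_free.
Qed.

End Mse.

(** * Choice of the parameters and passage to the limit *)

Lemma natr_ge_eventually (R : realType) (x : R) :
  exists n0 : nat, forall n, (n0 <= n)%N -> x <= n%:R.
Proof.
exists (Num.truncn x).+1 => n h; apply: ltW; apply: lt_le_trans (truncnS_gt x) _.
by rewrite ler_nat.
Qed.

Lemma expr2n_small (R : realType) (x v : R) : 0 <= x -> x < 1 -> 0 < v ->
  exists j : nat, (0 < j)%N /\ x ^+ (2 ^ j) <= v.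
Proof.
move=> x0 x1 v0.
have /cvgrPdist_le/(_ v v0)[k _ hk] : x ^+ k @[k --> \oo] --> 0.
  by apply: cvg_expr; rewrite ger0_norm.
exists k.+1; split => //.
have := hk (2 ^ k.+1)%N; rewrite /= sub0r normrN ger0_norm ?exprn_ge0//; apply.
by rewrite ltnW// (leq_trans (ltn_expl k (ltnSn 1)))// leq_exp2l.
Qed.

Lemma distance_matrix_le1 (R : realType) (K : metricType R) n (x : 'I_n -> K) :
  (diameter [set: K] <= 1)%E -> forall i j, `|distance_matrix x i j| <= 1.
Proof. by move=> dK i j; rewrite mxE ger0_norm ?mdist_ge0// mdist_le1. Qed.

Lemma distance_matrix_sym (R : realType) (K : metricType R) n (x : 'I_n -> K) i j :
  distance_matrix x i j = distance_matrix x j i.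
Proof. by rewrite !mxE metric_sym. Qed.

(** The constants admissible at size [n], uniformly in points, [p], model and data. Their infimum
    depends on [K], [n] and [eta] alone. *)
Definition usvt_mse_bound (R : realType) (eta : R) (K : metricType R) (n : nat) (c : R) : Prop :=
  forall (x : 'I_n -> K) (p : R), 0 < p -> p <= 1 ->
  forall (d : measure_display) (T : measurableType d)
    (P : probability T R) (mo : data_model)
    (X : 'I_n * 'I_n -> {RV P >-> R}) (O : 'I_n * 'I_n -> {RV P >-> bool})
    (Mhat : T -> 'M[R]_n),
    data_matrix mo p (distance_matrix x) X O ->
    (forall w, is_usvt eta (observed_matrix X O w)
                 (observed_proportion mo O w) (Mhat w)) ->
    (MSE P Mhat (distance_matrix x) <= (c / Num.sqrt p)%:E)%E.

Section Limit.
Context (R : realType) (eta : R) (eta_gt0 : 0 < eta) (eta_lt1 : eta < 1).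
Context (K : metricType R).
Hypotheses (K_compact : compact [set: K]) (K_diam : (diameter [set: K] <= 1)%E).

Lemma mse_le4 n (x : 'I_n -> K) (d : measure_display) (T : measurableType d)
    (P : probability T R) (mo : data_model)
    (X : 'I_n * 'I_n -> {RV P >-> R}) (O : 'I_n * 'I_n -> {RV P >-> bool})
    (Mhat : T -> 'M[R]_n) : (0 < n)%N ->
  (forall w, is_usvt eta (observed_matrix X O w)
                 (observed_proportion mo O w) (Mhat w)) ->
  (MSE P Mhat (distance_matrix x) <= 4%:E)%E.
Proof.
move=> n0 us; rewrite /MSE; apply: (@le_trans _ _ (mean_value P (fun=> 4))%:E); last by rewrite mean_cst.
apply: expectation_le_mean => [w|w|]; last exact: bm_cst; last first.
  exact: (loss_le4 (distance_matrix_le1 x K_diam) n0 us).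
by rewrite mulr_ge0 ?invr_ge0 ?sqr_ge0//; do 2! apply: sumr_ge0 => ? _; rewrite sqr_ge0.
Qed.

(** The parameters are chosen in the order [eps], which fixes the rank [rk], then [omega], [j],
    [gamma], [tau], and finally the size [n]. No choice refers to the data, which gives the
    uniformity. *)
Lemma mse_vanishes (e delta : R) : 0 < e -> 0 < delta ->
  exists n0 : nat, forall n, (n0 <= n)%N -> (0 < n)%N ->
  forall (x : 'I_n -> K) (p : R), delta <= p -> p <= 1 ->
  forall (d : measure_display) (T : measurableType d)
    (P : probability T R) (mo : data_model)
    (X : 'I_n * 'I_n -> {RV P >-> R}) (O : 'I_n * 'I_n -> {RV P >-> bool})
    (Mhat : T -> 'M[R]_n),
    data_matrix mo p (distance_matrix x) X O ->
    (forall w, is_usvt eta (observed_matrix X O w)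
                 (observed_proportion mo O w) (Mhat w)) ->
    (MSE P Mhat (distance_matrix x) <= e%:E)%E.
Proof.
move=> e0 d0.
have h0 := eta_gt0; have h1 := eta_lt1.
(* The share of each of the five deterministic terms: [3 / delta ^+ 2 * (5 * b) = e / 2]. *)
have [b b0 bE] : exists2 b : R, 0 < b & b = e * delta ^+ 2 / 30.
  by eexists; last reflexivity; rewrite divr_gt0// mulr_gt0// exprn_gt0.
(* The bound for [kappa + omega], whose root times 3 is [b]. A quarter of it goes to [eps], a
   quarter to [omega] and half to the rank term. *)
have [s s0 sE] : exists2 s : R, 0 < s & s = (b / 3) ^+ 2.
  by eexists; last reflexivity; rewrite exprn_gt0// divr_gt0.
have [c1 c10 c1E] : exists2 c1 : R, 0 < c1 & c1 = 4 / (eta * Num.sqrt delta).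
  by eexists; last reflexivity; rewrite divr_gt0// mulr_gt0// sqrtr_gt0.
have [eps [eps0 eps1 eps2]] : exists eps : R, [/\ 0 < eps, 3 * eps <= b & c1 * eps <= s / 4].
  exists (Num.min (b / 3) (s / (4 * c1))); split.
  - by rewrite lt_min (divr_gt0 b0)// (divr_gt0 s0)// mulr_gt0.
  - by rewrite mulrC -ler_pdivlMr// ge_min lexx.
  - by rewrite mulrC -ler_pdivlMr// ge_min; apply/orP; right; rewrite invfM mulrA.
have [rk split] := distance_matrix_split K_compact K_diam eps0.
have c31 : 0 < 3 * c1 + 1 by rewrite addr_gt0// mulr_gt0.
have [omega om0 om1] : exists2 omega : R, 0 < omega & (3 * c1 + 1) * omega = s / 4.
  exists (s / 4 / (3 * c1 + 1)); first by rewrite !divr_gt0.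
  by rewrite mulrC divfK// gt_eqF.
have A4 : 4 < (2 + eta / 4) ^+ 2 by nra.
have [A A0 AE] : exists2 A : R, 0 < A & A = (2 + eta / 4) ^+ 2.
  by eexists; last reflexivity; lra.
(* The exceptional part is 4 times a sum of three terms, hence the share [e / 24] of each. *)
have [j [j0 hj]] : exists j : nat, (0 < j)%N /\ (4 / A) ^+ (2 ^ j) <= e / 24 * (omega / 2).
  apply: expr2n_small; first by rewrite divr_ge0// ltW.
    by rewrite ltr_pdivrMr// mul1r AE.
  by rewrite mulr_gt0// divr_gt0.
(* From [2 <= m] follows [m.+2 <= m.*2]: this leaves a spare factor [n] in [Hg], which absorbs the
   constants. *)
have [m m2 mE] : exists2 m : nat, (2 <= m)%N & m = (2 ^ j)%N.
  by eexists; last reflexivity; rewrite -[2%N]expn1 leq_exp2l.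
have rk0 : (0 : R) <= rk%:R by [].
have rk1 : 0 < rk%:R + 1 :> R by rewrite ltr_wpDl.
have [gamma ga0 ga1] : exists2 gamma : R, 0 < gamma & rk%:R * gamma <= b.
  exists (b / (rk%:R + 1)); first exact: divr_gt0.
  by rewrite mulrCA ler_piMr ?(ltW b0)// ler_pdivrMr// mul1r lerDl.
have [tau [tau0 tau1 tau2]] : exists tau : R,
    [/\ 0 < tau, tau <= delta * (eta / 6) & tau ^+ 2 <= b].
  set tau := Num.min (delta * (eta / 6)) (Num.min 1 b); exists tau.
  have tau0 : 0 < tau by rewrite !lt_min b0 ltr01 (mulr_gt0 d0)// divr_gt0.
  split => //; first by rewrite ge_min lexx.
  have t1 : tau <= 1 by rewrite !ge_min lexx orbT.
  have tb : tau <= b by rewrite !ge_min lexx !orbT.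
  by rewrite expr2 (le_trans _ tb)// ler_piMl// ltW.
have [q [q0 q1 q2]] : exists q : R,
    [/\ 0 <= q, 3 * rk%:R <= q * b & 2 * c1 * rk%:R <= q * s].
  have qa : 0 <= 3 * rk%:R / b by rewrite (divr_ge0 _ (ltW b0))// mulr_ge0.
  have qb : 0 <= 2 * c1 * rk%:R / s.
    by rewrite (divr_ge0 _ (ltW s0))// (mulr_ge0 (mulr_ge0 _ (ltW c10))).
  exists (3 * rk%:R / b + 2 * c1 * rk%:R / s); split; first exact: addr_ge0.
    by rewrite -ler_pdivrMr// lerDl.
  by rewrite -ler_pdivrMr// lerDr.
have [Cm Cm0 CmE] : exists2 Cm : R, 0 <= Cm &
    Cm = 8 ^+ (2 ^ j) * (2 ^ j).+1%:R ^+ (2 ^ j).*2.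
  by eexists; last reflexivity; rewrite mulr_ge0 ?exprn_ge0.
have [n1 H1] := natr_ge_eventually (q ^+ 2).
have [n2 H2] := natr_ge_eventually (Cm / (omega * delta ^+ (2 ^ j)) / (e / 24)).
have [n3 H3] := natr_ge_eventually (1 / tau ^+ 2 / (e / 24)).
have [n4 H4] := natr_ge_eventually (omega * A ^+ m / gamma ^+ m.*2).
exists (maxn (maxn n1 n2) (maxn n3 n4)) => n.
rewrite !geq_max => /andP[/andP[/H1 {}H1 /H2 {}H2] /andP[/H3 {}H3 /H4 {}H4]] n0.
move=> x p dp p1 d T P mo X O Mhat dm us.
have nR : (0 : R) < n%:R by rewrite ltr0n.
have p0 : 0 < p := lt_le_trans d0 dp.
have sn0 : 0 < Num.sqrt n%:R :> R by rewrite sqrtr_gt0.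
have qsn : q <= Num.sqrt n%:R by rewrite -[leLHS](ger0_norm q0) -sqrtr_sqr ler_sqrt.
have [a [z [D [MD a1 z1 D1]]]] := split n x.
have Hg : omega * n%:R * ((2 + eta / 4) * Num.sqrt (n%:R * p)) ^+ (2 ^ j).*2 <=
    (gamma * n%:R) ^+ (2 ^ j).*2.
  rewrite -mE (sqrt_pow_double _ _ (mulr_ge0 (ltW nR) (ltW p0))) -AE.
  have w0 : 0 <= omega * n%:R by rewrite mulr_ge0 ?(ltW om0).
  apply: (@le_trans _ _ (omega * n%:R * (A * n%:R) ^+ m)).
    rewrite ler_wpM2l// lerXn2r ?nnegrE ?mulr_ge0 ?(ltW A0) ?(ltW p0)//.
    by rewrite ler_wpM2l ?(ltW A0)// ler_piMr.
  have g1 : omega * A ^+ m <= n%:R * gamma ^+ m.*2.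
    by rewrite -ler_pdivrMr// exprn_gt0.
  have -> : omega * n%:R * (A * n%:R) ^+ m = omega * A ^+ m * n%:R ^+ m.+1.
    by rewrite exprMn exprS; ring.
  apply: le_trans (ler_wpM2r _ g1) _; first exact: exprn_ge0.
  have -> : n%:R * gamma ^+ m.*2 * n%:R ^+ m.+1 = gamma ^+ m.*2 * n%:R ^+ m.+2.
    by rewrite [n%:R ^+ m.+2]exprS; ring.
  rewrite exprMn ler_wpM2l ?exprn_ge0 ?(ltW ga0)// ler_weXn2l ?ler1n//.
  by rewrite -addn2 -addnn leq_add2l.
have r1 : c1 * (rk%:R / Num.sqrt n%:R) <= s / 2.
  rewrite mulrA ler_pdivrMr//.
  have : q * s <= Num.sqrt n%:R * s by rewrite ler_wpM2r ?(ltW s0).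
  by move: q2; lra.
have t2 : 3 * rk%:R / Num.sqrt n%:R <= b.
  rewrite ler_pdivrMr// (le_trans q1)// mulrC ler_wpM2l ?(ltW b0)//.
have k1 : kappa n eta rk eps omega delta + omega <= s.
  by rewrite /kappa -c1E !mulrDr; move: om1; lra.
have t1 : 3 * Num.sqrt (kappa n eta rk eps omega delta + omega) <= b.
  rewrite mulrC -ler_pdivlMr// -[leRHS]ger0_norm ?divr_ge0 ?(ltW b0)// -sqrtr_sqr -sE.
  by rewrite ler_wsqrtr.
have e2 : 3 / delta ^+ 2 * (5 * b) = e / 2.
  by rewrite bE; field; rewrite gt_eqF.
have first : 3 / delta ^+ 2 *
    (3 * Num.sqrt (kappa n eta rk eps omega delta + omega) +
     rk%:R * gamma + 3 * eps + 3 * rk%:R / Num.sqrt n%:R + tau ^+ 2) <= e / 2.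
  by rewrite -e2 ler_wpM2l ?divr_ge0 ?sqr_ge0//; lra.
have s1 : Cm / (omega * delta ^+ (2 ^ j)) / n%:R <= e / 24.
  by rewrite ler_pdivrMr// [leRHS]mulrC -ler_pdivrMr ?divr_gt0.
have s2 : 2 / omega * (4 / A) ^+ (2 ^ j) <= e / 24.
  by rewrite [leLHS]mulrC -ler_pdivlMr ?divr_gt0// invf_div.
have s3 : 1 / (tau ^+ 2 * n%:R) <= e / 24.
  have -> : 1 / (tau ^+ 2 * n%:R) = 1 / tau ^+ 2 / n%:R by field; rewrite !gt_eqF.
  by rewrite ler_pdivrMr// [leRHS]mulrC -ler_pdivrMr ?divr_gt0.
have main N (key : 'I_N -> 'I_N -> option ('I_n * 'I_n)) (l r : 'cV[R]_n -> 'cV[R]_N) :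
    walk_model mo key l r -> (MSE P Mhat (distance_matrix x) <= e%:E)%E.
  move=> wm; apply: le_trans (mse_le dm (distance_matrix_le1 x K_diam)
    (@distance_matrix_sym R K n x) wm h0 h1 n0 d0 dp p1 us (ltW eps0) om0 (ltW ga0) tau0
    MD a1 z1 D1 Hg tau1) _.
  by rewrite lee_fin -CmE -AE; lra.
case: mo dm us main => dm us main.
  exact: main (bip_walk_model R n).
exact: main (sym_walk_model R n).
Qed.

Let bounds n : set R := [set c | 0 <= c /\ usvt_mse_bound eta K n c].

Lemma usvt_mse_bound4 n : (0 < n)%N -> bounds n 4.
Proof.
move=> n0; split=> // x p p0 p1 d T P mo X O Mhat dm us.
apply: le_trans (mse_le4 x n0 us) _.
by rewrite lee_fin ler_peMr// -[leLHS]invr1 lef_pV2 ?posrE ?sqrtr_gt0// -sqrtr1 ler_wsqrtr.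
Qed.

(** For given data, the error times [Num.sqrt p] is a lower bound of all admissible constants, hence
    at most their infimum. The admissible constant 4 excludes an infinite error. *)
Lemma usvt_mse_bound_inf n : (0 < n)%N -> usvt_mse_bound eta K n (inf (bounds n)).
Proof.
move=> n0 x p p0 p1 d T P mo X O Mhat dm us.
have sp0 : 0 < Num.sqrt p by rewrite sqrtr_gt0.
have bd c : bounds n c -> (MSE P Mhat (distance_matrix x) <= (c / Num.sqrt p)%:E)%E.
  by case=> _ /(_ x p p0 p1 d T P mo X O Mhat dm us).
have mse0 : (0 <= MSE P Mhat (distance_matrix x))%E.
  apply: expectation_ge0 => w.
  by rewrite mulr_ge0 ?invr_ge0 ?sqr_ge0//; do 2! apply: sumr_ge0 => ? _; rewrite sqr_ge0.
move: mse0 bd; case: (MSE P Mhat _) => [y| |] // y0 bd; last first.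
  by have := bd 4 (usvt_mse_bound4 n0).
rewrite lee_fin ler_pdivlMr//; apply: lb_le_inf; first by exists 4; exact: usvt_mse_bound4.
by move=> c /bd; rewrite lee_fin ler_pdivlMr.
Qed.

(** It suffices that [e] is eventually admissible. If [p] is at least [(e / 4) ^+ 2], then
    [mse_vanishes] applies; otherwise the trivial bound 4 is at most [e / Num.sqrt p]. *)
Lemma usvt_mse_bound_cvg : inf (bounds n) @[n --> \oo] --> (0 : R).
Proof.
apply/cvgrPdist_le => e e0.
have [n0 hn0] := mse_vanishes e0
  (exprn_gt0 2 (divr_gt0 e0 (ltr0Sn R 3))).
exists (maxn n0 1) => // n /=; rewrite geq_max => /andP[n0n n1].
have lb : lbound (bounds n) 0 by move=> c [].
have be : bounds n e.
  split=> [|x p p0 p1 d T P mo X O Mhat dm us]; first exact: ltW.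
  have sp0 : 0 < Num.sqrt p by rewrite sqrtr_gt0.
  have [pd|pd] := leP ((e / 4) ^+ 2) p.
    apply: le_trans (hn0 n n0n n1 x p pd p1 d T P mo X O Mhat dm us) _.
    by rewrite lee_fin ler_peMr ?(ltW e0)// -[leLHS]invr1 lef_pV2 ?posrE// -sqrtr1 ler_wsqrtr.
  apply: le_trans (mse_le4 x n1 us) _.
  rewrite lee_fin ler_pdivlMr// mulrC -ler_pdivlMr//.
  by rewrite -[leRHS]ger0_norm ?divr_ge0 ?(ltW e0)// -sqrtr_sqr ler_wsqrtr// ltW.
rewrite sub0r normrN ger0_norm; first by apply: ge_inf => //; exists 0.
by apply: lb_le_inf => //; exists e.
Qed.

End Limit.

Theorem theorem2p4 (R : realType) (eta : R) (eta_gt0 : 0 < eta) (eta_lt1 : eta < 1) :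
  exists (c : R) (Ceps : R -> R), 0 < c /\
    forall K : metricType R,
      compact [set: K] -> (diameter [set: K] <= 1)%E ->
      exists CK : nat -> R, (CK n @[n --> \oo] --> (0 : R)) /\
        forall (n : nat) (x : 'I_n -> K) (p eps : R),
          (1 <= n)%N -> 0 <= p -> p <= 1 ->
          0 < eps -> n%:R `^ (-1 + eps) <= p ->
          forall (d : measure_display) (T : measurableType d)
            (P : probability T R) (mo : data_model)
            (X : 'I_n * 'I_n -> {RV P >-> R})
            (O : 'I_n * 'I_n -> {RV P >-> bool})
            (Mhat : T -> 'M[R]_n),
            data_matrix mo p (distance_matrix x) X O ->
            (forall w, is_usvt eta (observed_matrix X O w)
                         (observed_proportion mo O w) (Mhat w)) ->
            (MSE P Mhat (distance_matrix x)
               <= (CK n / Num.sqrt p + Ceps eps * expR (- c * n%:R * p))%:E)%E.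
Proof.
exists 1, (fun=> 0); split=> // K cK dK.
exists (fun n => inf [set c | 0 <= c /\ usvt_mse_bound eta K n c]).
split; first exact: usvt_mse_bound_cvg.
move=> n x p eps n1 _ p1 _ pn d T P mo X O Mhat dm us.
(* Positivity of [p] is read off from the lower bound by a power of [n]. *)
have p0 : 0 < p by apply: lt_le_trans pn; rewrite powR_gt0// ltr0n.
by rewrite mul0r addr0; exact: (usvt_mse_bound_inf dK n1 p0 p1 dm us).
Qed.
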